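(* Let $I$ and $J$ be disjoint index sets, and let $f$ and $g$ be series in $\mathbb{C}_0\langle\!\langle z_k:k\in I\sqcup J\rangle\!\rangle$ such that $\mathrm{bReta}(f)=g$. (1) For all $n\ge1$ and $\alpha:\{1,\dots,n\}\to I\sqcup J$, $$\mathrm{Cf}_{(\alpha(1),\dots,\alpha(n))}(g)=\sum_{\pi\in\mathrm{BNC}(\chi_\alpha),\ \pi\ll_{\chi_\alpha}1_{\chi_\alpha}}\mathrm{Cf}_{(\alpha(1),\dots,\alpha(n));\pi}(f).$$ (2) For all $n\ge1$ and $\alpha:\{1,\dots,n\}\to I\sqcup J$, $$\mathrm{Cf}_{(\alpha(1),\dots,\alpha(n))}(f)=\sum_{\pi\in\mathrm{BNC}(\chi_\alpha),\ \pi\ll_{\chi_\alpha}1_{\chi_\alpha}}(-1)^{|\pi|-1}\,\mathrm{Cf}_{(\alpha(1),\dots,\alpha(n));\pi}(g).$$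
   Context: For $\chi:\{1,\dots,n\}\to\{\ell,r\}$ with $\chi^{-1}(\{\ell\})=\{i_1<\cdots<i_p\}$ and $\chi^{-1}(\{r\})=\{i_{p+1}>\cdots>i_n\}$, let $\prec_\chi$ be the total order $i_1\prec_\chi\cdots\prec_\chi i_n$. $\mathrm{BNC}(\chi)$ is the set of partitions of $\{1,\dots,n\}$ that are non-crossing with respect to $\prec_\chi$, with maximal element $1_\chi=\{\{1,\dots,n\}\}$ for refinement $\le$; $\mathrm{BI}(\chi)$ is the set of partitions all of whose blocks are intervals for $\prec_\chi$. $|\pi|$ is the number of blocks of $\pi$. For $\sigma,\pi\in\mathrm{BNC}(\chi)$, $\sigma\ll_\chi\pi$ means $\sigma\le\pi$ and for every block $V$ of $\pi$ there is a block $W$ of $\sigma$ with $\min_{\prec_\chi}(V),\max_{\prec_\chi}(V)\in W$. For $V=\{v_1<\cdots<v_s\}$, $(x_1,\dots,x_n)|_V=(x_{v_1},\dots,x_{v_s})$ and $\chi|_V$ is regarded as a map on $\{1,\dots,s\}$. For $\alpha:\{1,\dots,n\}\to I\sqcup J$, $\chi_\alpha(k)=\ell$ if $\alpha(k)\in I$ and $\chi_\alpha(k)=r$ if $\alpha(k)\in J$. $\mathbb{C}_0\langle\!\langle z_k:k\in I\sqcup J\rangle\!\rangle$ is the set of formal power series with complex coefficients and zero constant term in non-commuting indeterminates $z_k$. $\mathrm{Cf}_{(\alpha(1),\dots,\alpha(n))}(f)$ is the coefficient of $z_{\alpha(1)}\cdots z_{\alpha(n)}$ in $f$, and $\mathrm{Cf}_{(\alpha(1),\dots,\alpha(n));\pi}(f)=\prod_{V\in\pi}\mathrm{Cf}_{(\alpha(1),\dots,\alpha(n))|_V}(f)$.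 For a unital algebra $\mathcal{A}$ with unital linear functional $\varphi$, the $(\ell,r)$-cumulants $\kappa_\chi$ and B-$(\ell,r)$-cumulants $B_\chi$ are the unique multilinear functionals $\mathcal{A}^n\to\mathbb{C}$ with $\varphi(x_1\cdots x_n)=\sum_{\pi\in\mathrm{BNC}(\chi)}\prod_{V\in\pi}\kappa_{\chi|_V}((x_1,\dots,x_n)|_V)=\sum_{\pi\in\mathrm{BI}(\chi)}\prod_{V\in\pi}B_{\chi|_V}((x_1,\dots,x_n)|_V)$ for all $n\geq 1,\chi,x_j$. $\mathcal{D}_{\mathrm{alg}}(I\sqcup J)$ is the set of unital linear functionals $\mu:\mathbb{C}\langle Z_k:k\in I\sqcup J\rangle\to\mathbb{C}$. For such $\mu$ (with cumulants taken with respect to $\mu$), $\mathcal{R}_\mu$ and $\eta_\mu$ are the series in $\mathbb{C}_0\langle\!\langle z_k\rangle\!\rangle$ whose coefficients of $z_{\alpha(1)}\cdots z_{\alpha(n)}$ are $\kappa_{\chi_\alpha}(Z_{\alpha(1)},\dots,Z_{\alpha(n)})$ and $B_{\chi_\alpha}(Z_{\alpha(1)},\dots,Z_{\alpha(n)})$ respectively. The maps $\mathcal{R},\eta:\mathcal{D}_{\mathrm{alg}}(I\sqcup J)\to\mathbb{C}_0\langle\!\langle z_k\rangle\!\rangle$ are bijections, and $\mathrm{bReta}=\eta\circ\mathcal{R}^{-1}$. *)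

(* Defs.v *)
From HB Require Import structures.
From mathcomp Require Import all_boot all_order all_algebra.
From mathcomp Require Import reals complex finmap monalg.
From Stdlib Require Import ClassicalEpsilon.

Set Implicit Arguments.
Unset Strict Implicit.
Unset Printing Implicit Defensive.

Import GRing.Theory.

Local Open Scope ring_scope.

Variant side := Lside | Rside.

Section BiNonCrossing.

Variable n : nat.
Implicit Types (chi : 'I_n -> side) (V W : {set 'I_n}).
Implicit Types pi sigma : {set {set 'I_n}}.

(* i_1 < ... < i_p on the left side, followed by i_{p+1} > ... > i_n on the
   right side. *)
Definition prec chi (i j : 'I_n) : bool :=
  match chi i, chi j with
  | Lside, Lside => (i < j)%N
  | Lside, Rside => true
  | Rside, Lside => false
  | Rside, Rside => (j < i)%N
  end.

Definition crossing chi V W : bool :=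
  [exists a in V, exists b in W, exists c in V, exists d in W,
     [&& prec chi a b, prec chi b c & prec chi c d]].

Definition BNC chi : {set {set {set 'I_n}}} :=
  [set pi | partition pi [set: 'I_n] &&
     [forall V in pi, forall W in pi, (V != W) ==> ~~ crossing chi V W]].

Definition interval chi V : bool :=
  [forall a in V, forall c in V, forall b,
     prec chi a b && prec chi b c ==> (b \in V)].

Definition BI chi : {set {set {set 'I_n}}} :=
  [set pi | partition pi [set: 'I_n] && [forall V in pi, interval chi V]].

Definition refines sigma pi : bool :=
  [forall W in sigma, exists V in pi, W \subset V].

Definition is_min chi V m : bool :=
  (m \in V) && [forall v in V, (v == m) || prec chi m v].

Definition is_max chi V m : bool :=
  (m \in V) && [forall v in V, (v == m) || prec chi v m].

Definition ll chi sigma pi : bool :=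
  refines sigma pi &&
  [forall V in pi, exists W in sigma, exists a in W, exists b in W,
     is_min chi V a && is_max chi V b].

(* The maximal element 1_chi. *)
Definition one_part : {set {set 'I_n}} := [set [set: 'I_n]].

(* x|_V: the function [enum_val] lists the elements of V increasingly. *)
Definition restr (T : Type) (x : 'I_n -> T) V : 'I_#|V| -> T :=
  fun k => x (enum_val k).

End BiNonCrossing.

Arguments one_part {n}.
Arguments restr {n T} x V.

Section Cumulants.

Variables (C : comNzRingType) (A : algType C).

Record unital_functional := UnitalFunctional {
  ufun :> {scalar A};
  ufun1 : ufun 1 = 1
}.

(* The members indexed by n = 0 play no role. *)
Definition functionals := forall n, ('I_n -> side) -> ('I_n -> A) -> C.

Definition multilinear n (F : ('I_n -> A) -> C) : Prop :=
  forall (x : 'I_n -> A) (i : 'I_n),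
    scalar (fun u : A => F (dfwith x (i := i) u)).

Definition cumulants_over
    (P : forall n, ('I_n -> side) -> {set {set {set 'I_n}}})
    (phi : unital_functional) (kappa : functionals) : Prop :=
  (forall n (chi : 'I_n -> side), (0 < n)%N -> multilinear (kappa n chi)) /\
  (forall n (chi : 'I_n -> side) (x : 'I_n -> A), (0 < n)%N ->
     phi (\prod_(i < n) x i) =
     \sum_(pi in P n chi) \prod_(V in pi)
        kappa #|V| (restr chi V) (restr x V)).

(* Such families are unique for n >= 1, so any choice of one will do. *)
Definition the_functionals (Q : functionals -> Prop) : functionals :=
  epsilon (inhabits (fun _ _ _ => 0)) Q.

Definition lr_cumulant (phi : unital_functional) : functionals :=
  the_functionals (cumulants_over BNC phi).

Definition B_lr_cumulant (phi : unital_functional) : functionals :=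
  the_functionals (cumulants_over BI phi).

End Cumulants.

Section FreeAlgebra.

Variables (C : comNzRingType) (K : choiceType).

(* monalg declares an algebra structure only over commutative monomials and
   a left algebra otherwise, so an alias is needed to carry the missing axiom
   for words. *)
Definition ncpoly : predArgType := {malg C[{fmonom K}]}.

HB.instance Definition _ := GRing.Lalgebra.on ncpoly.

Fact ncpoly_scalerAr (c : C) (p q : ncpoly) : c *: (p * q) = p * (c *: q).
Proof.
apply/malgP=> k.
rewrite mcoeffZ mcoeffMl (mcoeffMlw k (fsubset_refl _) (msuppZ_le c q)).
rewrite mulr_sumr; apply: eq_bigr => k1 _.
rewrite mulr_sumr; apply: eq_bigr => k2 _.
by rewrite mulrnAr mcoeffZ mulrCA.
Qed.

HB.instance Definition _ :=
  GRing.Lalgebra_isAlgebra.Build C ncpoly ncpoly_scalerAr.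

Definition ncvar (k : K) : ncpoly := << fmu k >>.

Definition const_coef (p : ncpoly) : C := p@_(mone : {fmonom K}).

Fact const_coef_is_scalar : scalar const_coef.
Proof. by move=> c p q; rewrite /const_coef mcoeffD mcoeffZ. Qed.

HB.instance Definition _ :=
  GRing.isLinear.Build C ncpoly C _ const_coef const_coef_is_scalar.

Fact const_coef1 : const_coef 1 = 1.
Proof. by rewrite /const_coef mcoeff1 eqxx. Qed.

End FreeAlgebra.

Section Transforms.

Variables (R : realType) (I J : choiceType).
Local Notation C := R[i].
Local Notation K := (I + J)%type.

(* Power series without constant term, given by their coefficients on words. *)
Record series0 := Series0 {
  coef :> seq K -> C;
  coef_nil : coef [::] = 0
}.

Definition Cf n (alpha : 'I_n -> K) (f : series0) : C :=
  f [seq alpha k | k <- enum 'I_n].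

Definition Cf_part n (alpha : 'I_n -> K) (pi : {set {set 'I_n}})
    (f : series0) : C :=
  \prod_(V in pi) Cf (restr alpha V) f.

Definition chi_of n (alpha : 'I_n -> K) : 'I_n -> side :=
  fun k => if alpha k is inl _ then Lside else Rside.

Definition Dalg := unital_functional (ncpoly C K).

Definition const_coef_Dalg : Dalg := UnitalFunctional (const_coef1 C K).

(* The series with the given coefficients, for n >= 1. *)
Definition series_of (c : forall n, ('I_n -> K) -> C) : series0 :=
  @Series0 (fun w => if w is [::] then 0 else c (size w) (tnth (in_tuple w)))
    erefl.

Definition Rtransform (mu : Dalg) : series0 :=
  series_of (fun n alpha =>
    lr_cumulant mu (chi_of alpha) (fun k => ncvar C (alpha k))).

Definition eta_transform (mu : Dalg) : series0 :=
  series_of (fun n alpha =>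
    B_lr_cumulant mu (chi_of alpha) (fun k => ncvar C (alpha k))).

(* [Rtransform] is a bijection. *)
Definition Rtransform_inv (f : series0) : Dalg :=
  epsilon (inhabits const_coef_Dalg) (fun mu => Rtransform mu = f).

Definition bReta (f : series0) : series0 := eta_transform (Rtransform_inv f).

End Transforms.

(* Main.v *)
(** Fix [alpha] and order the positions by [prec (chi_of alpha)]; then [f] and [g]
   become functions on the subsets of a finite totally ordered set, and
   [bReta f = g] says that for every subset [V] the sum of the products of [f]
   over the non-crossing partitions of [V] equals the sum of the products of [g]
   over the interval partitions of [V], both being the moment of the word on [V].

   Cutting [V] after the last element of the block that contains [min V] writes
   a non-crossing sum as an irreducible sum (the partitions [<< 1]) times a
   non-crossing sum; comparing with the same cut for interval partitions gives
   formula (1) by induction.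

   Formula (2) says that the map sending [F] to [-] (its irreducible sum) is an
   involution. Write [H] for the image of [F]. An irreducible sum is obtained by
   inserting non-crossing partitions in the gaps of the outer block. Doing this
   first with [F] and then with [H], each gap of the inner block receives the sum,
   over its subsets [U], of the non-crossing sum of [F] on [U] times those of [H]
   on the gaps of [U]. By induction this sum vanishes on every nonempty gap, so
   only the term [F V] is left. *)

Require Import Defs.
From HB Require Import structures.
From mathcomp Require Import all_boot all_order all_algebra.
From mathcomp Require Import reals complex finmap monalg.
From Stdlib Require Import ClassicalEpsilon FunctionalExtensionality.

Set Implicit Arguments.
Unset Strict Implicit.
Unset Printing Implicit Defensive.

Import GRing.Theory.
Local Open Scope ring_scope.

(** * Sums over set partitions *)

Section SetPartitions.

Variables (T : finType) (C : comNzRingType).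
Implicit Types (B D P Q S U V W : {set T}) (pi rho : {set {set T}}).
Implicit Types (F G H phi : {set T} -> C).

Lemma partition_block_eq pi V B D x :
  partition pi V -> B \in pi -> D \in pi -> x \in B -> x \in D -> B = D.
Proof.
move=> /partition_trivIset tI piB piD xB xD.
by rewrite -(def_pblock tI piB xB) (def_pblock tI piD xD).
Qed.

Lemma partition_blockP pi V x :
  partition pi V -> x \in V -> exists2 B, B \in pi & x \in B.
Proof. by move=> /cover_partition <- /bigcupP. Qed.

Lemma partition_intro pi V :
    (forall B, B \in pi -> B != set0) ->
    (forall B, B \in pi -> B \subset V) ->
    (forall x, x \in V -> exists2 B, B \in pi & x \in B) ->
    (forall B D x, B \in pi -> D \in pi -> x \in B -> x \in D -> B = D) ->
  partition pi V.
Proof.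
move=> ne sub cov uniq; apply/and3P; split.
- apply/eqP/setP=> x; apply/bigcupP/idP=> [[B piB xB]|/cov[B piB xB]].
    exact: (subsetP (sub B piB)).
  by exists B.
- apply/trivIsetP=> B D piB piD /negP neq; apply/pred0P=> x /=.
  by apply/negP=> /andP[xB xD]; apply: neq; rewrite (uniq B D x).
- by apply/negP=> /ne; rewrite eqxx.
Qed.

(** A partition with every block inside [P] or inside [Q] is a pair of partitions, one of each set.
    The hypothesis on [p] says that [p] admits only such partitions and factors over the pair. *)
Lemma sum_partitions_union P Q (p a b : pred {set {set T}}) F :
    [disjoint P & Q] ->
    (forall pi, partition pi (P :|: Q) ->
      p pi = [&& [forall B in pi, (B \subset P) || (B \subset Q)],
                 a (pi ::&: P) & b (pi ::&: Q)]) ->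
  \sum_(pi | partition pi (P :|: Q) && p pi) \prod_(B in pi) F B =
  (\sum_(pi | partition pi P && a pi) \prod_(B in pi) F B) *
  (\sum_(pi | partition pi Q && b pi) \prod_(B in pi) F B).
Proof.
move=> dPQ pE; rewrite big_distrlr pair_big /=.
have disj x : x \in P -> x \in Q -> False.
  by move=> xP xQ; move/pred0P/(_ x): dPQ; rewrite /= xP xQ.
pose h (r : {set {set T}} * {set {set T}}) := r.1 :|: r.2.
pose h' pi : {set {set T}} * {set {set T}} := (pi ::&: P, pi ::&: Q).
have subPQ pi : [forall B in pi, (B \subset P) || (B \subset Q)] ->
    pi ::&: P :|: pi ::&: Q = pi.
  move=> /forall_inP sub; apply/setP=> B; rewrite !inE -andb_orr.
  by case: (boolP (B \in pi)) => //= /sub.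
have partR pi V W : partition pi (V :|: W) ->
    (forall x, x \in V -> x \in W -> False) ->
    [forall B in pi, (B \subset V) || (B \subset W)] -> partition (pi ::&: V) V.
  move=> part dVW /forall_inP sub; apply: partition_intro.
  - by move=> B; rewrite inE => /andP[piB _]; apply: partition_neq0 part piB.
  - by move=> B; rewrite inE => /andP[].
  - move=> x xV; case: (partition_blockP (x := x) part) => [|B piB xB].
      by rewrite inE xV.
    exists B => //; rewrite inE piB; case/orP: (sub _ piB) => // BW.
    by case: (dVW x) => //; apply: (subsetP BW).
  - move=> B D x; rewrite !inE => /andP[piB _] /andP[piD _].
    exact: partition_block_eq part piB piD.
rewrite (reindex_onto h h') /=; last first.
  by move=> pi /andP[part]; rewrite (pE _ part) => /and3P[/subPQ].
have hK r : partition r.1 P -> partition r.2 Q -> h' (h r) = r.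
  case: r => r1 r2 /= p1 p2; rewrite /h' /h /=; congr (_, _); apply/setP=> B;
    rewrite !inE.
  - apply/andP/idP=> [[/orP[] //] r2B BP|r1B]; last first.
      by rewrite r1B (partitionS p1).
    case/set0Pn: (partition_neq0 p2 r2B) => x xB.
    case: (disj x); first exact: (subsetP BP).
    exact: (subsetP (partitionS p2 r2B)).
  - apply/andP/idP=> [[/orP[] //] r1B BQ|r2B]; last first.
      by rewrite r2B orbT (partitionS p2).
    case/set0Pn: (partition_neq0 p1 r1B) => x xB.
    case: (disj x); last exact: (subsetP BQ).
    exact: (subsetP (partitionS p1 r1B)).
have cond r : partition (h r) (P :|: Q) && p (h r) && (h' (h r) == r) =
    (partition r.1 P && a r.1) && (partition r.2 Q && b r.2).
  apply/idP/idP.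
    case/andP=> /andP[part]; rewrite pE // => /and3P[sub ha hb] /eqP hr.
    have [r1E r2E] : r.1 = h r ::&: P /\ r.2 = h r ::&: Q.
      by split; rewrite -[in LHS]hr.
    rewrite r1E r2E ha hb !andbT (partR _ _ _ part) //=.
    apply: (partR _ Q P); rewrite 1?setUC //.
      by move=> x xQ xP; apply: (disj x).
    by apply/forall_inP=> B rB; rewrite orbC; apply: (forall_inP sub).
  case/andP=> /andP[p1 ha] /andP[p2 hb].
  have hr := hK _ p1 p2; rewrite hr eqxx andbT.
  have part : partition (h r) (P :|: Q).
    apply: partition_intro.
    - move=> B; rewrite inE => /orP[] rB.
        exact: partition_neq0 p1 rB.
      exact: partition_neq0 p2 rB.
    - move=> B; rewrite inE => /orP[/(partitionS p1) s|/(partitionS p2) s].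
        exact: subset_trans s (subsetUl _ _).
      exact: subset_trans s (subsetUr _ _).
    - move=> x; rewrite inE.
      move=> /orP[/(partition_blockP p1)|/(partition_blockP p2)] [B rB xB];
        by exists B => //; rewrite inE rB ?orbT.
    - move=> B D x; rewrite !inE => /orP[] rB /orP[] rD xB xD.
      + exact: partition_block_eq p1 rB rD xB xD.
      + by case: (disj x); [apply: (subsetP (partitionS p1 rB))
                           |apply: (subsetP (partitionS p2 rD))].
      + by case: (disj x); [apply: (subsetP (partitionS p1 rD))
                           |apply: (subsetP (partitionS p2 rB))].
      + exact: partition_block_eq p2 rB rD xB xD.
  have [r1E r2E] : h r ::&: P = r.1 /\ h r ::&: Q = r.2.
    by split; rewrite -[in RHS]hr.
  rewrite part pE // r1E r2E ha hb !andbT /=.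
  apply/forall_inP=> B; rewrite inE.
  by move=> /orP[/(partitionS p1)->|/(partitionS p2)->]; rewrite ?orbT.
apply: eq_big => [r|r]; first exact: cond.
rewrite cond => /andP[/andP[p1 _] /andP[p2 _]].
rewrite /h (eq_bigl [predU r.1 & r.2]) => [|B]; last by rewrite !inE.
apply: bigU; apply/pred0P=> B /=; apply/negP=> /andP[r1B r2B].
case/set0Pn: (partition_neq0 p1 r1B) => x xB.
by apply: (disj x);
  [apply: (subsetP (partitionS p1 r1B))|apply: (subsetP (partitionS p2 r2B))].
Qed.

(** Once the block [B] of [m] is chosen, the other blocks form an arbitrary partition of its
    complement. *)
Lemma sum_partitions_block V m (p : pred {set {set T}}) F :
    m \in V ->
  \sum_(pi | partition pi V && p pi) \prod_(B in pi) F B =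
  \sum_(B : {set T} | (m \in B) && (B \subset V)) F B *
     \sum_(pi | partition pi (V :\: B) && p (B |: pi)) \prod_(D in pi) F D.
Proof.
move=> mV; under [RHS]eq_bigr do rewrite mulr_sumr.
rewrite pair_big_dep /=.
pose h (r : {set T} * {set {set T}}) := r.1 |: r.2.
pose h' pi := (pblock pi m, pi :\ pblock pi m).
have pbl pi : partition pi V -> pblock pi m \in pi.
  by move=> part; rewrite pblock_mem // (cover_partition part).
rewrite (reindex_onto h h') /=; last first.
  by move=> pi /andP[/pbl mpi _]; rewrite /h /= setD1K.
have notin B rho : m \in B -> partition rho (V :\: B) -> B \notin rho.
  move=> mB part; apply/negP=> /(partitionS part)/subsetP/(_ m mB).
  by rewrite !inE mB.
have cond r : partition (h r) V && p (h r) && (h' (h r) == r) =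
    ((m \in r.1) && (r.1 \subset V)) &&
    (partition r.2 (V :\: r.1) && p (r.1 |: r.2)).
  apply/idP/idP=> [/andP[/andP[part ph]] /eqP hr|/andP[/andP[mr rV] /andP[part ph]]].
    have r1E : r.1 = pblock (h r) m by rewrite -[in LHS]hr.
    have r2E : r.2 = h r :\ r.1 by rewrite r1E -[in LHS]hr.
    have rh : r.1 \in h r by rewrite !inE eqxx.
    have mr : m \in r.1 by rewrite r1E mem_pblock (cover_partition part).
    by rewrite mr (partitionS part rh) ph r2E (partitionD1 part rh).
  have partU : partition (h r) V.
    have -> : V = r.1 :|: (V :\: r.1).
      by rewrite setDE setUIr setUCr setIT; apply/esym/setUidPr.
    apply: partitionU1 => //; first by apply/set0Pn; exists m.
    by rewrite -setI_eq0 setIDA setIC -setIDA setDv setI0.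
  have r1h : r.1 \in h r by rewrite !inE eqxx.
  have pE : pblock (h r) m = r.1.
    exact: def_pblock (partition_trivIset partU) r1h mr.
  rewrite partU ph /h' pE /= /h; case: r {partU pE r1h ph} part mr rV => B rho /=.
  by move=> part mB _; rewrite setU1K ?eqxx // (notin B).
apply: eq_big => [r|r]; first by rewrite cond.
rewrite cond => /andP[/andP[mr rV] /andP[part ph]].
by rewrite /h big_setU1 // notin.
Qed.

End SetPartitions.

(** * Non-crossing and interval partitions of a totally ordered set *)

Section Cuts.

Variables (T : finType) (lt : rel T).
Implicit Types (B D S U V W : {set T}) (pi : {set {set T}}).

Record strict_order : Prop := StrictOrder {
  so_irr : irreflexive lt;
  so_trans : transitive lt;
  so_total : forall x y, x != y -> lt x y || lt y x
}.

Definition lo y S := [set x in S | lt x y].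
Definition hi y S := [set x in S | lt y x].

Definition cross B D : bool :=
  [exists a in B, exists b in D, exists c in B, exists d in D,
     [&& lt a b, lt b c & lt c d]].

Definition noncrossing pi : bool :=
  [forall B in pi, forall D in pi, (B != D) ==> ~~ cross B D].

(** Expresses that [B] lies in a single gap of [U], one element of [U] at a time so that the
    condition splits at a cut. *)
Definition avoids U B : bool :=
  [forall u in U, [forall b in B, lt b u] || [forall b in B, lt u b]].

Definition minimum V m : bool := (m \in V) && [forall v in V, (v == m) || lt m v].
Definition maximum V m : bool := (m \in V) && [forall v in V, (v == m) || lt v m].

(** The condition [pi << 1], read on the ordered set [V]. *)
Definition irreducible V pi : bool :=
  [exists W in pi, exists a in W, exists b in W, minimum V a && maximum V b].

(** Relative to [V], because the blocks left after removing an initial one are intervals of what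
    remains. *)
Definition interval_in V B : bool :=
  [forall a in B, forall c in B, forall b in V, lt a b && lt b c ==> (b \in B)].

Lemma crossP B D :
  reflect (exists a b c d, [/\ a \in B, b \in D, c \in B & d \in D] /\
                           [/\ lt a b, lt b c & lt c d]) (cross B D).
Proof.
apply: (iffP idP).
  case/exists_inP=> a aB /exists_inP[b bD /exists_inP[c cB /exists_inP[d dD]]].
  by case/and3P=> *; exists a, b, c, d.
case=> a [b [c [d [[aB bD cB dD] [ab bc cd]]]]].
apply/exists_inP; exists a => //; apply/exists_inP; exists b => //.
apply/exists_inP; exists c => //; apply/exists_inP; exists d => //.
by rewrite ab bc cd.
Qed.

Lemma noncrossingP pi :
  reflect (forall B D, B \in pi -> D \in pi -> B != D -> ~~ cross B D)
          (noncrossing pi).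
Proof.
apply: (iffP forall_inP) => [nc B D piB piD neq|nc B piB].
  by have /forall_inP/(_ D piD)/implyP := nc B piB; apply.
by apply/forall_inP=> D piD; apply/implyP=> neq; apply: nc.
Qed.

Hypothesis so : strict_order.

Let irr := so_irr so.
Let trans x y z := @so_trans so y x z.
Let total := so_total so.

Lemma lt_asym x y : lt x y -> lt y x = false.
Proof. by move=> xy; apply/negP=> /(trans xy); rewrite irr. Qed.

Lemma card_hi y S : y \in S -> (#|hi y S| < #|S|)%N.
Proof.
move=> yS; apply: proper_card; apply/properP; split; last first.
  by exists y => //; rewrite inE irr andbF.
by apply/subsetP=> x; rewrite inE => /andP[].
Qed.

Lemma minimum_exists S : S != set0 -> exists m, minimum S m.
Proof.
case/set0Pn=> x xS; case: (arg_minnP (fun y => #|lo y S|) xS) => m mS mP.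
exists m; apply/andP; split=> //; apply/forall_inP=> v vS; case: eqP => //= /eqP neq.
case/orP: (total neq) => // vm; suff: (#|lo v S| < #|lo m S|)%N.
  by rewrite ltnNge mP.
apply: proper_card; apply/properP; split.
  apply/subsetP=> z; rewrite !inE => /andP[-> zv]; exact: trans zv vm.
by exists v; rewrite !inE ?vS ?vm ?irr.
Qed.

Lemma minimum_mem S m : minimum S m -> m \in S.
Proof. by case/andP. Qed.

Lemma minimum_lt S m x : minimum S m -> x \in S -> x != m -> lt m x.
Proof. by case/andP=> _ /forall_inP mP /mP /orP[->|]. Qed.

Lemma minimum_lo S m : minimum S m -> lo m S = set0.
Proof.
move=> mP; apply/setP=> x; rewrite !inE; apply/negP=> /andP[xS xm].
case: (eqVneq x m) xm => [->|neq]; first by rewrite irr.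
by move/(trans (minimum_lt mP xS neq)); rewrite irr.
Qed.

Lemma lo_minimum S m : m \in S -> lo m S = set0 -> minimum S m.
Proof.
move=> mS lo0; rewrite /minimum mS; apply/forall_inP=> v vS.
case: eqP => //= /eqP neq; case/orP: (total neq) => // vm.
by move/setP/(_ v): lo0; rewrite !inE vS vm.
Qed.

Lemma minimum_unique S m m' : minimum S m -> minimum S m' -> m = m'.
Proof.
move=> mP mP'; apply/eqP/negPn/negP=> neq.
have := minimum_lt mP' (minimum_mem mP) neq.
by rewrite lt_asym // (minimum_lt mP) ?(minimum_mem mP') // eq_sym.
Qed.

Lemma minimum_hi S m : minimum S m -> hi m S = S :\ m.
Proof.
move=> mP; apply/setP=> x; rewrite !inE andbC.
case: (eqVneq x m) => [->|neq]; first by rewrite irr.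
by case: (boolP (x \in S)) => xS; rewrite ?andbF // (minimum_lt mP).
Qed.

Lemma minimum_setU1 y U : (forall u, u \in U -> lt y u) -> minimum (y |: U) y.
Proof.
move=> yU; rewrite /minimum !inE eqxx; apply/forall_inP=> v.
by rewrite !inE => /orP[->|/yU ->]; rewrite ?orbT.
Qed.

Lemma lo_cut y U1 U2 :
    {in U1, forall u, lt u y} -> {in U2, forall u, lt y u} ->
  lo y (U1 :|: (y |: U2)) = U1.
Proof.
move=> h1 h2; apply/setP=> x; rewrite !inE.
case: (boolP (x \in U1)) => [/h1 ->|_] //=.
case: eqP => [->|_] /=; first by rewrite irr.
by case: (boolP (x \in U2)) => [/h2 /lt_asym|].
Qed.

Lemma hi_cut y U1 U2 :
    {in U1, forall u, lt u y} -> {in U2, forall u, lt y u} ->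
  hi y (U1 :|: (y |: U2)) = U2.
Proof.
move=> h1 h2; apply/setP=> x; rewrite !inE.
case: eqP => [->|_] /=; first by rewrite irr andbF; apply/esym/negP=> /h2; rewrite irr.
case: (boolP (x \in U2)) => [/h2 ->|_]; first by rewrite orbT.
by rewrite orbF; apply/negP=> /andP[/h1/lt_asym->].
Qed.

Lemma cut_eq y U : y \in U -> lo y U :|: (y |: hi y U) = U.
Proof.
move=> yU; apply/setP=> x; rewrite !inE.
case: (eqVneq x y) => [->|/total]; first by rewrite orbT yU.
by case: (x \in U) => //= /orP[]->; rewrite ?orbT.
Qed.

Lemma lo_subset y U S : U \subset lo y S -> {in U, forall u, lt u y}.
Proof. by move=> /subsetP sub u /sub; rewrite inE => /andP[]. Qed.

Lemma hi_subset y U S : U \subset hi y S -> {in U, forall u, lt y u}.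
Proof. by move=> /subsetP sub u /sub; rewrite inE => /andP[]. Qed.

Lemma lo_sub y S : lo y S \subset S.
Proof. by apply/subsetP=> x; rewrite inE => /andP[]. Qed.

Lemma hi_sub y S : hi y S \subset S.
Proof. by apply/subsetP=> x; rewrite inE => /andP[]. Qed.

(** * Sums over subsets, cut at a point *)

Section Sums.

Variable C : comNzRingType.
Implicit Types F G H phi : {set T} -> C.

(** Cutting at [y] makes the choices below and above [y] independent; [lo] and [hi] recover them. *)
Lemma sum_subsets_through y S (Psi : {set T} -> C) : y \in S ->
  \sum_(U : {set T} | (U \subset S) && (y \in U)) Psi U =
  \sum_(U1 : {set T} | U1 \subset lo y S)
    \sum_(U2 : {set T} | U2 \subset hi y S) Psi (U1 :|: (y |: U2)).
Proof.
move=> yS; rewrite pair_big /=.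
rewrite (reindex_onto (fun r : {set T} * {set T} => r.1 :|: (y |: r.2))
                      (fun U => (lo y U, hi y U))) /=; last first.
  by move=> U /andP[_ yU]; rewrite cut_eq.
apply: eq_bigl => -[U1 U2] /=; apply/idP/idP.
  case/andP=> /andP[/subsetP sub yU] /eqP[e1 e2]; apply/andP.
  split; apply/subsetP=> x.
    by rewrite -{1}e1 !inE => /andP[xU ->]; rewrite sub ?inE.
  by rewrite -{1}e2 !inE => /andP[xU ->]; rewrite sub ?inE.
case/andP=> s1 s2.
rewrite lo_cut ?hi_cut ?eqxx ?andbT /=;
  try exact: (lo_subset s1); try exact: (hi_subset s2).
rewrite !inE eqxx orbT andbT; apply/subsetP=> x; rewrite !inE.
case/or3P=> [/(subsetP s1)|/eqP->|/(subsetP s2)] //; by rewrite inE => /andP[].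
Qed.

(** Sorts the nonempty subsets by their minimum [y]. *)
Lemma sum_subsets_min S (Psi : {set T} -> C) :
  \sum_(U : {set T} | U \subset S) Psi U =
  Psi set0 + \sum_(y in S) \sum_(U : {set T} | U \subset hi y S) Psi (y |: U).
Proof.
rewrite (bigD1 set0) ?sub0set //=; congr (_ + _).
transitivity (\sum_(U : {set T} | (U \subset S) && (U != set0))
    \sum_(y in S | minimum U y) Psi U).
  apply: eq_bigr => U /andP[US /minimum_exists[m mP]].
  rewrite (bigD1 m) /=; last by rewrite mP andbT (subsetP US) ?minimum_mem.
  rewrite big1 ?addr0 // => y /andP[/andP[_ yP] /eqP[]].
  exact: minimum_unique yP mP.
rewrite (exchange_big_dep (mem S)) /=; last by move=> U y _ /andP[].
apply: eq_bigr => y yS.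
(* Having minimum [y] means [lo y U = set0], so after the cut at [y] only the term [U1 = set0]
   survives. *)
transitivity (\sum_(U : {set T} | (U \subset S) && (y \in U))
    (if lo y U == set0 then Psi U else 0)).
  rewrite [RHS]big_mkcond [LHS]big_mkcond /=; apply: eq_bigr => U _.
  case: (boolP (U \subset S)) => //= US; case: (boolP (y \in U)) => /= yU.
    have -> : (U != set0) by apply/set0Pn; exists y.
    rewrite yS /=; case: eqP => [/(lo_minimum yU)->|neq] //.
    by case: ifP => // /minimum_lo.
  by case: ifP => // /andP[_ /andP[_ /minimum_mem]]; rewrite (negPf yU).
rewrite sum_subsets_through // (bigD1 set0) ?sub0set //= [X in _ + X]big1 ?addr0.
  apply: eq_bigr => U UH; rewrite set0U.
  rewrite minimum_lo ?eqxx //; apply: minimum_setU1; exact: hi_subset UH.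
move=> U1 /andP[s1 neq]; apply: big1 => U2 s2; rewrite lo_cut ?(negPf neq) //.
  exact: lo_subset s1.
exact: hi_subset s2.
Qed.

End Sums.
End Cuts.

(** * Non-crossing sums and the filling of gaps *)

Section PartitionSums.

Variables (T : finType) (lt : rel T) (C : comNzRingType).
Implicit Types (B D S U V W : {set T}) (pi : {set {set T}}).
Implicit Types F G H phi : {set T} -> C.

Local Notation lo := (lo lt).
Local Notation hi := (hi lt).
Local Notation noncrossing := (noncrossing lt).
Local Notation avoids := (avoids lt).

Definition NCsum F V : C :=
  \sum_(pi | partition pi V && noncrossing pi) \prod_(B in pi) F B.

Definition NCirr F V : C :=
  \sum_(pi | partition pi V && (noncrossing pi && irreducible lt V pi))
    \prod_(B in pi) F B.

Definition INTsum F V : C :=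
  \sum_(pi | partition pi V && [forall B in pi, interval_in lt V B])
    \prod_(B in pi) F B.

(* Non-crossing partitions of the gaps which [U] leaves in [S]. *)
Definition NCfill F U S : C :=
  \sum_(pi | partition pi (S :\: U) &&
             (noncrossing pi && [forall B in pi, avoids U B]))
    \prod_(B in pi) F B.

(** Non-crossing sums with one block singled out take this form: [phi] weighs that block, [F] the
    blocks in its gaps. *)
Definition insert F phi S : C :=
  \sum_(U : {set T} | U \subset S) phi U * NCfill F U S.

Hypothesis so : strict_order lt.
Let irr := so_irr so.
Let trans x y z := @so_trans _ _ so y x z.

Lemma NCsum0 F : NCsum F set0 = 1.
Proof.
rewrite /NCsum (big_pred1 set0) ?big_set0 // => pi /=.
rewrite partition_set0; case: eqP => // ->; apply/noncrossingP => B D.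
by rewrite inE.
Qed.

Lemma NCfill0 F S : NCfill F set0 S = NCsum F S.
Proof.
apply: eq_bigl => pi; rewrite setD0; congr (_ && _); apply/andb_idr => _.
by apply/forall_inP => B _; apply/forall_inP => u; rewrite inE.
Qed.

(* A block avoiding [U] lies on one side of each of its elements, and blocks on
   opposite sides of [y] do not cross. *)
Lemma NCfill_cut F U S y : U \subset S -> y \in U ->
  NCfill F U S = NCfill F (lo y U) (lo y S) * NCfill F (hi y U) (hi y S).
Proof.
move=> /subsetP US yU.
have SE : S :\: U = (lo y S :\: lo y U) :|: (hi y S :\: hi y U).
  apply/setP=> x; rewrite !inE.
  case: (eqVneq x y) => [->|/(so_total so)]; first by rewrite yU !irr !andbF.
  by case: (lt x y); case: (lt y x); case: (x \in U); case: (x \in S).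
rewrite /NCfill SE; apply: sum_partitions_union.
  apply/pred0P=> x /=; rewrite !inE; apply/negP.
  by move=> /andP[/and3P[_ _ xy] /and3P[_ _]]; rewrite (lt_asym so).
move=> pi part; apply/idP/idP.
- case/andP=> nc /forall_inP av.
  have side : [forall B in pi, (B \subset lo y S :\: lo y U)
                             || (B \subset hi y S :\: hi y U)].
    apply/forall_inP=> B piB; have /subsetP BSU := partitionS part piB.
    case/orP: (forall_inP (av B piB) y yU) => /forall_inP By; apply/orP;
      [left|right]; apply/subsetP=> x xB; have := BSU x xB; have := By x xB;
      rewrite !inE => xy; rewrite xy (lt_asym so xy); rewrite !andbT ?andbF ?orbF //=.
  rewrite side /=; apply/andP; split; apply/andP; split.
  + apply/noncrossingP=> B D; rewrite !inE => /andP[piB _] /andP[piD _].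
    exact: (noncrossingP _ _ nc).
  + apply/forall_inP=> B; rewrite inE => /andP[piB _]; apply/forall_inP=> u.
    rewrite inE => /andP[uU _]; exact: (forall_inP (av B piB)).
  + apply/noncrossingP=> B D; rewrite !inE => /andP[piB _] /andP[piD _].
    exact: (noncrossingP _ _ nc).
  + apply/forall_inP=> B; rewrite inE => /andP[piB _]; apply/forall_inP=> u.
    rewrite inE => /andP[uU _]; exact: (forall_inP (av B piB)).
- case/and3P=> /forall_inP side /andP[nc1 /forall_inP av1] /andP[nc2 /forall_inP av2].
  have sideP B : B \in pi ->
      (B \in pi ::&: (lo y S :\: lo y U) /\ {in B, forall b, lt b y}) \/
      (B \in pi ::&: (hi y S :\: hi y U) /\ {in B, forall b, lt y b}).
    move=> piB; case/orP: (side B piB) => sub; [left|right]; rewrite inE piB sub;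
      split=> // b /(subsetP sub); by rewrite !inE => /and3P[].
  apply/andP; split.
    apply/noncrossingP=> B D piB piD neq.
    case: (sideP B piB) (sideP D piD) => [[p1 h1]|[p1 h1]] [[p2 h2]|[p2 h2]].
    + exact: (noncrossingP _ _ nc1).
    + apply/negP=> /crossP[a [b [c [d [[aB bD cB dD] [ab bc cd]]]]]].
      have := trans bc (h1 c cB); by rewrite (lt_asym so (h2 b bD)).
    + apply/negP=> /crossP[a [b [c [d [[aB bD cB dD] [ab bc cd]]]]]].
      have := trans ab (h2 b bD); by rewrite (lt_asym so (h1 a aB)).
    + exact: (noncrossingP _ _ nc2).
  apply/forall_inP=> B piB; apply/forall_inP=> u uU.
  case: (eqVneq u y) => [->|/(so_total so) uy].
    by case: (sideP B piB) => [[_ h]|[_ h]]; apply/orP; [left|right];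
      apply/forall_inP.
  case: (sideP B piB) => [[p h]|[p h]]; case/orP: uy => uy.
  + by apply: (forall_inP (av1 B p)); rewrite inE uU.
  + by apply/orP; left; apply/forall_inP=> b /h /trans; apply.
  + by apply/orP; right; apply/forall_inP=> b /h; apply: trans.
  + by apply: (forall_inP (av2 B p)); rewrite inE uU.
Qed.

Lemma eq_insert F phi psi S :
    (forall U : {set T}, U \subset S -> phi U = psi U) ->
  insert F phi S = insert F psi S.
Proof. by move=> e; apply: eq_bigr => U US; rewrite e. Qed.

Lemma NCfill_min F S y U : y \in S -> U \subset hi y S ->
  NCfill F (y |: U) S = NCsum F (lo y S) * NCfill F U (hi y S).
Proof.
move=> yS Uy; have hU := hi_subset Uy.
rewrite (@NCfill_cut _ _ _ y) ?setU11 //; last first.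
  by rewrite subUset sub1set yS (subset_trans Uy) ?hi_sub.
rewrite -[y |: U]set0U (lo_cut so) ?(hi_cut so) ?NCfill0 // => u;
  by rewrite inE.
Qed.

(** Sorts by the least element [y] of [U]: the gap before [y] carries a free non-crossing sum, and
    the remaining elements of [U] are chosen after [y]. An empty [U] leaves all of [S] as one
    gap. *)
Lemma insert_min F phi S :
  insert F phi S = phi set0 * NCsum F S +
    \sum_(y in S) NCsum F (lo y S) * insert F (fun U => phi (y |: U)) (hi y S).
Proof.
rewrite /insert (sum_subsets_min so) NCfill0; congr (_ + _).
apply: eq_bigr => y yS; rewrite mulr_sumr; apply: eq_bigr => U Uy.
by rewrite NCfill_min // mulrCA.
Qed.

Lemma insert0 F phi : insert F phi set0 = phi set0.
Proof. by rewrite insert_min big_set0 NCsum0 mulr1 addr0. Qed.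

(** The other blocks fail to cross the block [B] of [m] exactly when each lies in one gap of
    [B :\ m]; [m] itself separates nothing, being below everything. The predicate [p] carries
    irreducibility along. *)
Lemma NCsum_peel F V m (p : pred {set {set T}}) : minimum lt V m ->
  \sum_(pi | partition pi V && (noncrossing pi && p pi)) \prod_(B in pi) F B =
  \sum_(B : {set T} | (m \in B) && (B \subset V)) F B *
    \sum_(pi | partition pi (V :\: B) &&
        ((noncrossing pi && [forall D in pi, avoids (B :\ m) D]) && p (B |: pi)))
      \prod_(D in pi) F D.
Proof.
move=> mP; have mV := minimum_mem mP; rewrite (sum_partitions_block _ _ mV).
apply: eq_bigr => B /andP[mB /subsetP BV]; congr (_ * _); apply: eq_bigl => pi.
case: (boolP (partition pi (V :\: B))) => //= part; congr (_ && _).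
have piP D x : D \in pi -> x \in D -> (x \in V) && (x \notin B).
  move=> piD xD; have := subsetP (partitionS part piD) x xD.
  by rewrite inE andbC.
have mlt D x : D \in pi -> x \in D -> lt m x.
  move=> piD xD; case/andP: (piP D x piD xD) => xV xB.
  by apply: (minimum_lt mP) => //; apply: contraNneq xB => ->.
apply/noncrossingP/andP=> [nc|[nc /forall_inP av] D E].
  split.
    by apply/noncrossingP=> D E piD piE; apply: nc; rewrite !inE ?piD ?piE orbT.
  apply/forall_inP=> D piD; apply/forall_inP=> u; rewrite !inE => /andP[um uB].
  have neq : B != D.
    apply/eqP=> BD; have := piP D m piD; rewrite -BD mB => /(_ isT) /andP[_].
    by [].
  have mu : lt m u by apply: (minimum_lt mP) => //; apply: BV.
  apply/orP; case: (boolP [forall b in D, lt b u]) => [|/forall_inPn[b bD nbu]].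
    by left.
  right; apply/forall_inP=> c cD.
  have nu x : x \in D -> x != u.
    by move=> xD; apply/eqP=> xu; case/andP: (piP D x piD xD); rewrite xu uB.
  have ub : lt u b.
    by have := so_total so (nu b bD); rewrite (negPf nbu).
  case/orP: (so_total so (nu c cD)) => // cu.
  suff: cross lt B D.
    by move=> cr; move: (nc B D); rewrite !inE eqxx piD orbT cr => /(_ isT isT neq).
  (* A block with elements [c] and [b] on both sides of [u] alternates with [m] and [u]. *)
  apply/crossP; exists m, c, u, b; split; split=> //; exact: mlt cD.
(* Conversely, a crossing with [B] puts an element of [B] other than [m] between two elements of the
   other block. *)
rewrite !inE => /orP[/eqP->|piD] /orP[/eqP->|piE] neq.
- by rewrite eqxx in neq.
- apply/negP=> /crossP[a [b [c [d [[aB bE cB dE] [ab bc cd]]]]]].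
  have cB' : c \in B :\ m.
    rewrite !inE cB andbT; apply: contraTneq bc => ->.
    by rewrite (lt_asym so) // (mlt E).
  case/orP: (forall_inP (av E piE) c cB') => /forall_inP h.
    by have := h d dE; rewrite (lt_asym so cd).
  by have := h b bE; rewrite (lt_asym so bc).
- apply/negP=> /crossP[a [b [c [d [[aD bB cD dB] [ab bc cd]]]]]].
  have bB' : b \in B :\ m.
    rewrite !inE bB andbT; apply: contraTneq ab => ->.
    by rewrite (lt_asym so) // (mlt D).
  case/orP: (forall_inP (av D piD) b bB') => /forall_inP h.
    by have := h c cD; rewrite (lt_asym so bc).
  by have := h a aD; rewrite (lt_asym so ab).
- exact: (noncrossingP _ _ nc).
Qed.

Lemma sum_subsets_with V m (Psi : {set T} -> C) : m \in V ->
  \sum_(B : {set T} | (m \in B) && (B \subset V)) Psi B =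
  \sum_(U : {set T} | U \subset V :\ m) Psi (m |: U).
Proof.
move=> mV; rewrite (reindex_onto (fun U => m |: U) (fun B => B :\ m)) /=.
  apply: eq_bigl => U; rewrite setU11 subUset sub1set mV /=.
  rewrite subsetD1; case: (boolP (m \in U)) => mU.
    rewrite andbF; apply/negP => /andP[_ /eqP /setP/(_ m)].
    by rewrite !inE eqxx mU.
  by rewrite setU1K // eqxx andbT.
by move=> B /andP[mB _]; rewrite setD1K.
Qed.

(** The block of the minimum is [m |: U], and the other blocks fill the gaps of [U] in [V :\ m]. *)
Lemma NCsum_min F V m : minimum lt V m ->
  NCsum F V = insert F (fun U => F (m |: U)) (V :\ m).
Proof.
move=> mP; have mV := minimum_mem mP.
transitivity (\sum_(pi | partition pi V && (noncrossing pi && true))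
                \prod_(B in pi) F B).
  by apply: eq_bigl => pi; rewrite andbT.
rewrite (NCsum_peel _ (fun _ => true) mP) sum_subsets_with //.
apply: eq_bigr => U UV; congr (_ * _); apply: eq_bigl => pi.
have mU : m \notin U by move: UV; rewrite subsetD1 => /andP[].
by rewrite andbT setU1K // setDDl.
Qed.

Lemma irreducibleP V pi m M : partition pi V ->
    minimum lt V m -> maximum lt V M ->
  reflect (exists2 W, W \in pi & (m \in W) && (M \in W)) (irreducible lt V pi).
Proof.
move=> part mP MP.
have maxu b : maximum lt V b -> b = M.
  case/andP=> bV /forall_inP bP; case/andP: MP => MV /forall_inP MP.
  case/orP: (bP M MV) => [/eqP|Mb] //; case/orP: (MP b bV) => [/eqP|bM] //.
  by rewrite (lt_asym so bM) in Mb.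
apply: (iffP exists_inP) => [[W piW]|[W piW /andP[mW MW]]].
  case/exists_inP=> a aW /exists_inP[b bW /andP[/(minimum_unique so mP) -> /maxu <-]].
  by exists W; rewrite ?aW ?bW.
exists W => //; apply/exists_inP; exists m => //; apply/exists_inP; exists M => //.
by rewrite mP MP.
Qed.

Lemma NCirr1 F m : NCirr F [set m] = F [set m].
Proof.
have mP : minimum lt [set m] m.
  by rewrite /minimum inE eqxx; apply/forall_inP=> v; rewrite inE => ->.
have MP : maximum lt [set m] m.
  by rewrite /maximum inE eqxx; apply/forall_inP=> v; rewrite inE => ->.
rewrite /NCirr (NCsum_peel _ _ mP) (big_pred1 [set m]) /=; last first.
  move=> B; rewrite subset1; case: (eqVneq B [set m]) => [->|/negPf neq] /=.
    by rewrite inE !eqxx.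
  by rewrite neq; case: (eqVneq B set0) => [->|_]; rewrite ?inE ?andbF.
rewrite setDv (big_pred1 set0) ?big_set0 ?mulr1 // => pi.
rewrite partition_set0 /=; case: eqP => //= ->; rewrite setU0.
rewrite -[_ = true]/(is_true _) -andbA; apply/and3P; split.
- by apply/noncrossingP=> B D; rewrite inE.
- by apply/forall_inP=> D; rewrite inE.
- apply/(irreducibleP _ mP MP); last by exists [set m]; rewrite ?inE ?eqxx.
  apply: partition_intro.
  + by move=> B; rewrite inE => /eqP->; apply/set0Pn; exists m; rewrite inE.
  + by move=> B; rewrite inE => /eqP->.
  + by move=> x xm; exists [set m]; rewrite // inE.
  + by move=> B D x; rewrite !inE => /eqP-> /eqP->.
Qed.

(** Irreducibility puts [m] and [M] in one block, so the other blocks fill gaps strictly between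
    them. *)
Lemma NCirr_ends F V m M : minimum lt V m -> maximum lt V M -> m != M ->
  NCirr F V = insert F (fun U => F (m |: (M |: U))) (V :\ m :\ M).
Proof.
move=> mP MP neq; have mV := minimum_mem mP; have MV : M \in V by case/andP: MP.
have ltM x : x \in V -> x != M -> lt x M.
  by move=> xV xM; case/andP: MP => _ /forall_inP/(_ x xV); rewrite (negPf xM).
rewrite /NCirr (NCsum_peel _ _ mP) (sum_subsets_with _ mV).
(* The terms with [M] outside the block of [m] vanish; for the others irreducibility is
   automatic. *)
transitivity (\sum_(U : {set T} | (M \in U) && (U \subset V :\ m))
   F (m |: U) * NCfill F U (V :\ m)).
  rewrite [LHS]big_mkcond [RHS]big_mkcond /=; apply: eq_bigr => U _.
  case: (boolP (U \subset V :\ m)) => UV; last by rewrite andbF.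
  have mU : m \notin U by move: UV; rewrite subsetD1 => /andP[].
  have partU pi : partition pi (V :\: (m |: U)) -> partition ((m |: U) |: pi) V.
    move=> part; have VE : V = (m |: U) :|: (V :\: (m |: U)).
      rewrite setDE setUIr setUCr setIT; apply/esym/setUidPr.
      by rewrite subUset sub1set mV (subset_trans UV) ?subsetDl.
    rewrite [X in partition _ X]VE; apply: partitionU1 => //.
      by apply/set0Pn; exists m; rewrite setU11.
    by rewrite -setI_eq0 setIDA setIC -setIDA setDv setI0.
  rewrite andbT; case: ifP => MU.
    congr (_ * _); apply: eq_bigl => pi; rewrite setU1K // setDDl.
    case: (boolP (partition pi _)) => //= part; apply/andb_idr => _.
    apply/(irreducibleP (partU _ part) mP MP).
    by exists (m |: U); rewrite ?setU11 // !inE MU orbT.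
  rewrite big1 ?mulr0 // => pi /andP[part /andP[_]].
  case/(irreducibleP (partU _ part) mP MP) => W piW /andP[mW MW].
  have WE : W = m |: U.
    by apply: (partition_block_eq (partU _ part) piW _ mW); rewrite setU11.
  by move: MW; rewrite WE !inE MU eq_sym (negPf neq).
rewrite sum_subsets_with; last by rewrite !inE eq_sym neq.
apply: eq_bigr => U UV; congr (_ * _).
have MU : M \notin U by move: UV; rewrite subsetD1 => /andP[].
have hU x : x \in V :\ m :\ M -> lt x M.
  by rewrite !inE => /and3P[xM _ xV]; apply: ltM.
(* Nothing lies above [M], so the upper factor of the cut is the non-crossing sum of the empty set,
   that is [1]. *)
rewrite (@NCfill_cut _ _ _ M) ?setU11 //; last first.
  rewrite subUset sub1set !inE eq_sym neq MV /=.
  by apply: subset_trans UV (subsetDl _ _).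
have VE : V :\ m = (V :\ m :\ M) :|: (M |: set0).
  by rewrite setU0 setUC setD1K // !inE eq_sym neq.
have UE : M |: U = U :|: (M |: set0) by rewrite setU0 setUC.
rewrite [in LHS]VE UE !(lo_cut so, hi_cut so) ?NCfill0 ?NCsum0 ?mulr1 //;
  try by move=> x; rewrite inE.
all: by move=> x; try move=> /(subsetP UV); apply: hU.
Qed.

End PartitionSums.

(** * Invariance under reversal of the order *)

Section Converse.

Variables (T : finType) (lt : rel T) (C : comNzRingType).
Hypothesis so : strict_order lt.
Implicit Types (B D S U V W : {set T}) (pi : {set {set T}}).
Implicit Types F G H phi : {set T} -> C.

Definition converse : rel T := fun x y => lt y x.

Lemma converse_strict_order : strict_order converse.
Proof.
split=> [x|x y z|x y neq]; first exact: (so_irr so).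
  by move=> xy zx; apply: (so_trans so) zx xy.
by rewrite orbC; apply: (so_total so).
Qed.

(** A crossing pattern read backwards starts in the other block. *)
Lemma cross_converse B D : cross converse B D = cross lt D B.
Proof.
by apply/crossP/crossP=> -[a [b [c [d [[? ? ? ?] [? ? ?]]]]]];
  exists d, c, b, a.
Qed.

Lemma noncrossing_converse pi : noncrossing converse pi = noncrossing lt pi.
Proof.
apply/noncrossingP/noncrossingP => nc B D piB piD neq;
  [rewrite -cross_converse|rewrite cross_converse]; apply: nc => //;
  by rewrite eq_sym.
Qed.

Lemma irreducible_converse V pi :
  irreducible converse V pi = irreducible lt V pi.
Proof.
apply: eq_existsb => W; congr (_ && _).
by apply/exists_inP/exists_inP=> -[a aW /exists_inP[b bW /andP[aP bP]]];
  exists b => //; apply/exists_inP; exists a => //; apply/andP.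
Qed.

Lemma NCsum_converse F V : NCsum converse F V = NCsum lt F V.
Proof. by apply: eq_bigl => pi; rewrite noncrossing_converse. Qed.

Lemma NCirr_converse F V : NCirr converse F V = NCirr lt F V.
Proof.
by apply: eq_bigl => pi; rewrite noncrossing_converse irreducible_converse.
Qed.

Lemma insert_converse F phi S : insert converse F phi S = insert lt F phi S.
Proof.
apply: eq_bigr => U _; congr (_ * _); apply: eq_bigl => pi.
rewrite noncrossing_converse; congr (_ && (_ && _)); apply: eq_forallb => B.
by congr (_ ==> _); apply: eq_forallb => u; rewrite orbC.
Qed.

End Converse.

(** * Formula (1) for functions on subsets *)

Section Transfer.

Variables (T : finType) (lt : rel T) (C : comNzRingType).
Hypothesis so : strict_order lt.
Implicit Types (B D S U V W : {set T}) (pi : {set {set T}}).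
Implicit Types F G H phi : {set T} -> C.

Local Notation lo := (lo lt).
Local Notation hi := (hi lt).
Local Notation NCsum := (NCsum lt).
Local Notation NCirr := (NCirr lt).
Local Notation INTsum := (INTsum lt).
Local Notation insert := (insert lt).

Lemma maximum_exists S : S != set0 -> exists m, maximum lt S m.
Proof. exact: (minimum_exists (converse_strict_order so)). Qed.

(** The mirror image of [insert_min], sorting by the greatest element of [U]. *)
Lemma insert_max F phi S :
  insert F phi S = phi set0 * NCsum F S +
    \sum_(y in S) insert F (fun U => phi (y |: U)) (lo y S) * NCsum F (hi y S).
Proof.
rewrite -insert_converse (insert_min (converse_strict_order so)).
rewrite NCsum_converse; congr (_ + _); apply: eq_bigr => y _.
by rewrite mulrC insert_converse NCsum_converse.
Qed.

Lemma initial_minimum V m y :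
  minimum lt V m -> y \in V -> minimum lt (y |: lo y V) m.
Proof.
move=> mP yV; apply/andP; split.
  rewrite !inE (minimum_mem mP) /=; case: (eqVneq m y) => //= neq.
  by rewrite (minimum_lt mP) // eq_sym.
apply/forall_inP=> v; rewrite !inE => vP; case: eqP => //= /eqP neq.
by rewrite (minimum_lt mP) //; case/orP: vP => [/eqP->|/andP[]].
Qed.

Lemma initial_maximum V y : maximum lt (y |: lo y V) y.
Proof.
apply/andP; split; first by rewrite setU11.
by apply/forall_inP=> v; rewrite !inE => /orP[->|/andP[_ ->]]; rewrite ?orbT.
Qed.

(* Cutting after the last element of the block that contains the minimum. *)
Lemma NCsum_irr F V : V != set0 ->
  NCsum F V = \sum_(y in V) NCirr F (y |: lo y V) * NCsum F (hi y V).
Proof.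
case/(minimum_exists so)=> m mP; have mV := minimum_mem mP.
(* The last element of the block [m |: U] is [m] when [U] is empty and the greatest element of [U]
   otherwise. *)
rewrite (NCsum_min so _ mP) insert_max [RHS](bigD1 m) //=; congr (_ + _).
  by rewrite (minimum_lo so mP) setU0 NCirr1 // (minimum_hi so mP).
rewrite [RHS](eq_bigl (mem (V :\ m))); last by move=> y; rewrite !inE andbC.
apply: eq_bigr => y; rewrite !inE => /andP[ym yV].
have mlt := minimum_lt mP yV ym; congr (_ * _); last first.
  congr NCsum; apply/setP=> x; rewrite !inE.
  by case: eqP => // ->; rewrite (lt_asym so mlt) !andbF.
rewrite (NCirr_ends so _ (initial_minimum mP yV) (initial_maximum V y)) 1?eq_sym //.
congr insert; apply/setP=> x; rewrite !inE.
by case: (eqVneq x y) => [->|_] /=; rewrite ?(so_irr so) ?andbF // andbA.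
Qed.

Lemma INTsum0 F : INTsum F set0 = 1.
Proof.
rewrite /INTsum (big_pred1 set0) ?big_set0 // => pi /=.
rewrite partition_set0; case: eqP => // ->; apply/forall_inP => B.
by rewrite inE.
Qed.

(** In an interval partition the block of the minimum is an initial segment, determined by its last
    element [y]; the rest is an interval partition of what lies above [y]. *)
Lemma INTsum_initial G V : V != set0 ->
  INTsum G V = \sum_(y in V) G (y |: lo y V) * INTsum G (hi y V).
Proof.
case/(minimum_exists so)=> m mP; have mV := minimum_mem mP.
pose init B := [forall b in B, forall a in V, lt a b ==> (a \in B)].
rewrite /INTsum (sum_partitions_block _ _ mV).
transitivity (\sum_(B in [set y |: lo y V | y in V]) G B * INTsum G (V :\: B)).
  rewrite [LHS]big_mkcond [RHS]big_mkcond /=; apply: eq_bigr => B _.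
  have -> : (B \in [set y |: lo y V | y in V]) = [&& m \in B, B \subset V & init B].
    apply/imsetP/and3P=> [[y yV ->]|[mB BV /forall_inP iB]].
      split; first exact: minimum_mem (initial_minimum mP yV).
        by rewrite subUset sub1set yV lo_sub.
      apply/forall_inP=> b; rewrite !inE => bP; apply/forall_inP=> a aV.
      apply/implyP=> ab; rewrite !inE aV /=; apply/orP; right.
      by case/orP: bP => [/eqP <-|/andP[_]] //; apply: (so_trans so).
    have [|M /andP[MB /forall_inP MP]] := @maximum_exists B.
      by apply/set0Pn; exists m.
    exists M; first exact: (subsetP BV).
    apply/setP=> x; rewrite !inE; apply/idP/orP=> [xB|[/eqP->|/andP[xV xM]]] //.
      by case/orP: (MP x xB) => [|xM]; [left|right; rewrite (subsetP BV)].
    by have /forall_inP/(_ x xV)/implyP := iB M MB; apply.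
  rewrite andbA; case: ifP => //= /andP[mB BV].
  have intP pi : partition pi (V :\: B) ->
      [forall D in B |: pi, interval_in lt V D] =
      init B && [forall D in pi, interval_in lt (V :\: B) D].
    move=> part.
    apply/forall_inP/andP=> [h|[/forall_inP iB /forall_inP h] D].
      split.
        apply/forall_inP=> b bB; apply/forall_inP=> a aV; apply/implyP=> ab.
        case: (eqVneq a m) => [->|am] //.
        have /forall_inP/(_ m mB)/forall_inP/(_ b bB)/forall_inP/(_ a aV) :=
          h B (setU11 _ _).
        by move/implyP; apply; rewrite ab (minimum_lt mP).
      apply/forall_inP=> D piD; apply/forall_inP=> a aD; apply/forall_inP=> c cD.
      apply/forall_inP=> b; rewrite inE => /andP[_ bV].
      by have /forall_inP/(_ a aD)/forall_inP/(_ c cD)/forall_inP/(_ b bV) :=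
        h D (setU1r _ piD).
    rewrite !inE => /orP[/eqP->|piD].
      apply/forall_inP=> a aB; apply/forall_inP=> c cB; apply/forall_inP=> b bV.
      apply/implyP=> /andP[_ bc].
      by have /forall_inP/(_ b bV)/implyP := iB c cB; apply.
    apply/forall_inP=> a aD; apply/forall_inP=> c cD; apply/forall_inP=> b bV.
    apply/implyP=> /andP[ab bc].
    have := subsetP (partitionS part piD) a aD; rewrite inE => /andP[aB aV].
    have bB : b \notin B.
      apply: contra aB => bB.
      by have /forall_inP/(_ a aV)/implyP := iB b bB; apply.
    have /forall_inP/(_ a aD)/forall_inP/(_ c cD)/forall_inP/(_ b) := h D piD.
    by rewrite inE bB bV ab bc => /(_ isT).
  case: ifP => iB; last first.
    by rewrite big1 ?mulr0 // => pi /andP[/intP->]; rewrite iB.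
  congr (_ * _); apply: eq_bigl => pi.
  by case: (boolP (partition pi _)) => //= /intP ->; rewrite iB.
rewrite big_imset /=.
  apply: eq_bigr => y yV; congr (_ * INTsum G _); apply/setP=> x; rewrite !inE.
  case: (eqVneq x y) => [->|/(so_total so)]; first by rewrite yV (so_irr so).
  case: (boolP (x \in V)) => //= _; rewrite ?andbF // andbT.
  by case/orP=> xy; rewrite xy (lt_asym so xy).
(* The segment determines [y] as its maximum. *)
move=> y z yV zV e; apply: (minimum_unique (converse_strict_order so)).
  exact: initial_maximum V y.
by rewrite e; apply: initial_maximum.
Qed.

(** Both sums obey the same recursion over cuts, so by induction on the size of [V] the terms at [y]
    other than the maximum agree and cancel. *)
Theorem INT_of_NC F G :
    (forall V, NCsum F V = INTsum G V) -> forall V, V != set0 -> G V = NCirr F V.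
Proof.
move=> FG V; elim/ltn_ind: {V}#|V| {-2}V (erefl #|V|) => k IH V cV V0.
have [M MP] := maximum_exists V0; have MV : M \in V by case/andP: MP.
have MhiE : hi M V = set0 := minimum_lo (converse_strict_order so) MP.
have MloE : M |: lo M V = V.
  apply/setP=> x; rewrite !inE; case: eqP => [->|/eqP neq] //=.
  case: (boolP (x \in V)) => //= xV.
  by case/andP: MP => _ /forall_inP/(_ x xV); rewrite (negPf neq).
(* The term at the maximum [M] is the one that involves [V] itself, with nothing left above. *)
have := FG V; rewrite NCsum_irr // INTsum_initial // !(bigD1 M MV) /=.
rewrite MhiE MloE NCsum0 INTsum0 !mulr1.
rewrite [X in _ + X = _](eq_bigr (fun y => G (y |: lo y V) * INTsum G (hi y V))).
  by move/addIr.
move=> y /andP[yV' yM]; have yV : y \in V := yV'; rewrite FG (IH _ _ _ erefl) //.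
  rewrite -cV; apply: proper_card; apply/properP; split.
    by rewrite subUset sub1set yV lo_sub.
  exists M; rewrite // !inE eq_sym (negPf yM) MV /=.
  have /andP[_ /forall_inP/(_ y yV)] := MP.
  by rewrite (negPf yM) /= => /(lt_asym so)->.
by apply/set0Pn; exists y; rewrite setU11.
Qed.

End Transfer.

(** * Formula (2): the irreducible sum with a sign is an involution *)

Section Inversion.

Variables (T : finType) (lt : rel T) (C : comNzRingType).
Hypothesis so : strict_order lt.
Implicit Types (B D S U V W : {set T}) (pi : {set {set T}}).
Implicit Types F G H phi : {set T} -> C.

Local Notation lo := (lo lt).
Local Notation hi := (hi lt).
Local Notation NCsum := (NCsum lt).
Local Notation NCirr := (NCirr lt).
Local Notation NCfill := (NCfill lt).
Local Notation insert := (insert lt).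

(** The mirror cut, before the first element of the block containing the maximum. *)
Lemma NCsum_irr_r F V : V != set0 ->
  NCsum F V = \sum_(y in V) NCsum F (lo y V) * NCirr F (y |: hi y V).
Proof.
move=> V0; rewrite -NCsum_converse (NCsum_irr (converse_strict_order so)) //.
by apply: eq_bigr => y _; rewrite NCirr_converse NCsum_converse mulrC.
Qed.

(** Expands the inner insertion at its least element [y], exchanges the sums and cuts the outer set
    [U] at [y]; the choices below [y] recombine into [insert H (NCsum F) (lo y S)]. *)
Lemma insert_insert F H phi S :
  insert H (insert F phi) S = phi set0 * insert H (NCsum F) S +
    \sum_(y in S) insert H (NCsum F) (lo y S) *
                  insert H (insert F (fun U => phi (y |: U))) (hi y S).
Proof.
rewrite {1 3}/insert.
under eq_bigr => U US do rewrite insert_min // mulrDl -mulrA mulr_suml.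
rewrite big_split /= -mulr_sumr; congr (_ + _).
rewrite (exchange_big_dep (mem S)) /=; last first.
  by move=> U y US yU; apply: (subsetP US).
apply: eq_bigr => y yS.
rewrite (sum_subsets_through so (fun U => NCsum F (lo y U) *
  insert F (fun U => phi (y |: U)) (hi y U) * NCfill H U S)) //.
rewrite mulr_suml; apply: eq_bigr => U1 s1; rewrite mulr_sumr.
have h1 := lo_subset s1.
apply: eq_bigr => U2 s2; have h2 := hi_subset s2.
rewrite (@NCfill_cut _ _ _ so _ _ _ y) ?(lo_cut so) ?(hi_cut so) //.
- by rewrite -!mulrA; congr (_ * _); rewrite mulrCA.
- rewrite !subUset sub1set yS (subset_trans s1) ?lo_sub //.
  by rewrite (subset_trans s2) ?hi_sub.
- by rewrite !inE eqxx orbT.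
Qed.

(** In [insert_insert] the vanishing kills every [y] with something of [S] below it. Only the
    minimum survives; it moves into the argument of [phi], which is why the induction generalizes
    over [phi]. *)
Lemma insert_insert_id F H phi S :
    (forall S' : {set T}, S' \subset S -> S' != set0 -> insert H (NCsum F) S' = 0) ->
  insert H (insert F phi) S = phi S.
Proof.
elim/ltn_ind: {S}#|S| {-2}S (erefl #|S|) phi => k IH S cS phi van.
rewrite insert_insert; case: (eqVneq S set0) => [->|S0].
  by rewrite big_set0 insert0 // NCsum0 // mulr1 addr0.
rewrite van // mulr0 add0r; case: (minimum_exists so S0) => m mP.
have mS := minimum_mem mP.
rewrite (bigD1 m) //= big1 ?addr0 => [|y /andP[yS ym]].
  rewrite (minimum_lo so mP) insert0 // NCsum0 // mul1r.
  rewrite (IH _ _ _ erefl) ?(minimum_hi so mP) ?setD1K //.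
    by rewrite -cS [X in (_ < X)%N](cardsD1 m) mS.
  by move=> S' s'; apply: van; apply: subset_trans s' (subsetDl _ _).
rewrite van ?mul0r ?lo_sub //; apply/set0Pn; exists m.
by rewrite inE mS (minimum_lt mP).
Qed.

(** Sorting by the least element [y] of [U] and cutting [NCsum H S] from the right give two sums
    with the same factor [NCsum H (lo y S)]; the cofactors are [F] and [NCirr H] on [y |: hi y S],
    which cancel. *)
Lemma insert_NCsum_eq0 F H S : S != set0 ->
    (forall V, V \subset S -> V != set0 -> F V = - NCirr H V) ->
  insert H (NCsum F) S = 0.
Proof.
elim/ltn_ind: {S}#|S| {-2}S (erefl #|S|) => k IH S cS S0 FH.
rewrite insert_min // NCsum0 // mul1r NCsum_irr_r // -big_split /=.
apply: big1 => y yS; rewrite -mulrDr.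
(* Since [y] is the minimum of [y |: U], this is a double insertion; by induction it collapses on
   the smaller set [hi y S]. *)
have -> : insert H (fun U => NCsum F (y |: U)) (hi y S) = F (y |: hi y S).
  rewrite -(@insert_insert_id F H (fun U => F (y |: U)) (hi y S)).
    apply: eq_insert => U Uy; have mP := minimum_setU1 (hi_subset Uy).
    rewrite (NCsum_min so _ mP) setU1K //.
    by apply/negP=> /(hi_subset Uy); rewrite (so_irr so).
  move=> S' s' S'0; apply: (IH _ _ _ erefl) => //.
    by rewrite -cS (leq_ltn_trans (subset_leq_card s')) // card_hi.
  by move=> V VS; apply: FH; apply: subset_trans VS (subset_trans s' (hi_sub _ _ _)).
rewrite FH ?addrN ?mulr0 //; first by rewrite subUset sub1set yS hi_sub.
by apply/set0Pn; exists y; rewrite setU11.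
Qed.

(** By induction on the size of [V]: a single point is settled by [NCirr1]; otherwise [m] and [M]
    are set aside and both insertions take place in the interior [S]. *)
Theorem NCirr_involutive F V : V != set0 ->
  F V = - NCirr (fun W => - NCirr F W) V.
Proof.
pose H W := - NCirr F W.
elim/ltn_ind: {V}#|V| {-2}V (erefl #|V|) => k IH V cV V0.
have [m mP] := minimum_exists so V0; have [M MP] := maximum_exists so V0.
have mV := minimum_mem mP; have MV : M \in V by case/andP: MP.
case: (eqVneq m M) => [mM|neq].
  have -> : V = [set m].
    apply/setP=> x; rewrite inE; apply/idP/eqP => [xV|->] //.
    apply/eqP/negPn/negP=> xm; have := minimum_lt mP xV xm.
    case/andP: MP => _ /forall_inP/(_ x xV); rewrite -mM (negPf xm) /=.
    by move/(lt_asym so) ->.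
  by rewrite !NCirr1 // opprK.
rewrite (NCirr_ends so _ mP MP neq).
pose S := V :\ m :\ M; pose phi U := F (m |: (M |: U)).
have memS U : U \subset S -> [/\ m \notin U, M \notin U & U \subset V].
  rewrite !subsetD1 => /andP[/andP[-> ->] ->]; by [].
have phiE U : U \subset S -> NCirr F (m |: (M |: U)) = insert F phi U.
  case/memS=> mU MU UV; have W_V : m |: (M |: U) \subset V.
    by rewrite !subUset !sub1set mV MV.
  have mP' : minimum lt (m |: (M |: U)) m.
    apply/andP; split; first by rewrite setU11.
    case/andP: mP => _ /forall_inP h; apply/forall_inP=> v /(subsetP W_V).
    exact: h.
  have MP' : maximum lt (m |: (M |: U)) M.
    apply/andP; split; first by rewrite !inE eqxx orbT.
    case/andP: MP => _ /forall_inP h; apply/forall_inP=> v /(subsetP W_V).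
    exact: h.
  rewrite (NCirr_ends so _ mP' MP' neq) setU1K ?setU1K //.
  by rewrite !inE negb_or neq.
have cardS : (#|S| < k)%N.
  rewrite -cV; apply: proper_card; apply/properP.
  by split; [case: (memS S)|exists m => //; case: (memS S)].
apply: oppr_inj; rewrite opprK.
transitivity (insert H (fun U => - insert F phi U) S); last first.
  by apply: eq_insert => U US; rewrite /H phiE.
rewrite [RHS](_ : _ = - insert H (insert F phi) S); last first.
  by rewrite /insert -sumrN; apply: eq_bigr => U _; rewrite mulNr.
(* The vanishing required on subsets of [S] comes from the induction hypothesis, [S] being smaller
   than [V]. *)
rewrite insert_insert_id //.
  by rewrite /phi /S !setD1K // !inE eq_sym neq.
move=> S' s' S'0; apply: insert_NCsum_eq0 => // W WS' W0.
apply: (IH _ _ _ erefl) => //; apply: leq_ltn_trans cardS.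
by apply: subset_leq_card; apply: subset_trans s'.
Qed.

End Inversion.

(** * The order of [chi] and restriction to a block *)

(** Used with [e := enum_val], to carry partitions of index sets to partitions of a block. *)
Lemma sum_partitions_imset (A T : finType) (C : comNzRingType) (e : A -> T)
    (D : {set A}) (p : pred {set {set T}}) (F : {set T} -> C) : injective e ->
  \sum_(pi | partition pi (e @: D) && p pi) \prod_(B in pi) F B =
  \sum_(pi : {set {set A}} | partition pi D && p [set e @: (B : {set A}) | B in pi])
    \prod_(B in pi) F (e @: B).
Proof.
move=> inj.
pose h (pi : {set {set A}}) := [set e @: (B : {set A}) | B in pi].
pose h' (pi : {set {set T}}) := [set e @^-1: (B : {set T}) | B in pi].
have preK (B : {set A}) : e @^-1: (e @: B) = B.
  by apply/setP=> x; rewrite inE mem_imset.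
have hK : cancel h h'.
  move=> pi; rewrite /h /h' -imset_comp -[RHS]imset_id.
  by apply: eq_imset => B /=; rewrite preK.
rewrite (reindex_onto h h') /=.
  apply: eq_big => [pi|pi _]; first by rewrite hK eqxx andbT imset_partition.
  by rewrite big_imset //= => B B' _ _; apply: imset_inj.
move=> pi /andP[part _]; rewrite /h /h' -imset_comp -[RHS]imset_id.
apply: eq_in_imset => B piB /=; apply/setP=> x.
apply/imsetP/idP=> [[y + ->]|xB]; first by rewrite inE.
have /imsetP[y yD xe] := subsetP (partitionS part piB) x xB.
by exists y; rewrite // inE -xe.
Qed.

Section Chi.

Variables (n : nat) (chi : 'I_n -> side).

Lemma prec_strict_order : strict_order (prec chi).
Proof.
split=> [x|y x z|x y neq]; rewrite /prec.
- by case: (chi x); rewrite ltnn.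
- case: (chi x); case: (chi y); case: (chi z) => //; first exact: ltn_trans.
  by move=> yx zy; apply: ltn_trans zy yx.
- have : (x < y)%N || (y < x)%N by rewrite -neq_ltn.
  by case: (chi x); case: (chi y) => //; rewrite orbC.
Qed.

Lemma sum_BNC (C : comNzRingType) (F : {set 'I_n} -> C) :
  \sum_(pi in BNC chi) \prod_(B in pi) F B = NCsum (prec chi) F setT.
Proof. by apply: eq_bigl => pi; rewrite inE. Qed.

Lemma sum_BI (C : comNzRingType) (F : {set 'I_n} -> C) :
  \sum_(pi in BI chi) \prod_(B in pi) F B = INTsum (prec chi) F setT.
Proof.
apply: eq_bigl => pi; rewrite inE; congr (_ && _).
apply: eq_forallb => B; congr (_ ==> _).
apply: eq_forallb => a; congr (_ ==> _).
apply: eq_forallb => c; congr (_ ==> _).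
by apply: eq_forallb => b; rewrite inE.
Qed.

(** Every partition refines [1], so only the condition on the extreme elements is left. *)
Lemma ll_one_part pi : partition pi [set: 'I_n] ->
  ll chi pi one_part = irreducible (prec chi) setT pi.
Proof.
move=> part; rewrite /ll; have -> : refines pi one_part.
  apply/forall_inP=> B piB; apply/exists_inP; exists setT; rewrite ?inE //.
apply/forall_inP/idP => [/(_ setT)|irr V]; first by rewrite inE; apply.
by rewrite inE => /eqP->.
Qed.

Lemma sum_ll (C : comNzRingType) (F : {set 'I_n} -> C) :
  \sum_(pi in BNC chi | ll chi pi one_part) \prod_(B in pi) F B =
  NCirr (prec chi) F setT.
Proof.
apply: eq_bigl => pi; rewrite inE -andbA.
by case: (boolP (partition pi setT)) => //= part; rewrite ll_one_part.
Qed.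

End Chi.

Lemma enum_sorted n (V : {set 'I_n}) : sorted (relpre val ltn) (enum V).
Proof.
have tr : transitive (relpre (val : 'I_n -> nat) ltn).
  by move=> y x z; apply: ltn_trans.
rewrite {1}/enum_mem; apply: (sorted_filter tr).
by rewrite -enumT -sorted_map val_enum_ord iota_ltn_sorted.
Qed.

(** * Identification of a block with its ordinals *)

Section EnumVal.

Variables (n : nat) (V : {set 'I_n}).

Let e : 'I_#|V| -> 'I_n := enum_val.

Lemma enum_val_mono : {mono e : i j / (i < j)%N}.
Proof.
have homo (i j : 'I_#|V|) : (i < j)%N -> (e i < e j)%N.
  move=> ij; have x0 := e i; rewrite /e !(enum_val_nth x0).
  apply: (sorted_ltn_nth (leT := relpre val ltn)) => //; first 1 last.
  - exact: enum_sorted.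
  - by rewrite inE -cardE.
  - by rewrite inE -cardE.
  by move=> y x z; apply: ltn_trans.
move=> i j; case: (ltngtP i j) => [/homo->//|/homo ji|/ord_inj ->].
  by rewrite ltnNge ltnW.
by rewrite ltnn.
Qed.

Lemma imset_enum_val : e @: setT = V.
Proof.
apply/setP=> x; apply/imsetP/idP=> [[i _ ->]|xV]; first exact: enum_valP.
by exists (enum_rank_in xV x); rewrite // /e enum_rankK_in.
Qed.

(** Both lists are strictly increasing and have the same members. *)
Lemma enum_imset (W : {set 'I_#|V|}) : enum (e @: W) = map e (enum W).
Proof.
have tr : transitive (relpre (val : 'I_n -> nat) ltn).
  by move=> y x z; apply: ltn_trans.
apply: (irr_sorted_eq tr) => [x|||x].
- exact: ltnn.
- exact: enum_sorted.
- rewrite sorted_map (eq_sorted (e' := relpre val ltn)) ?enum_sorted //.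
  exact: enum_val_mono.
- rewrite mem_enum; apply/imsetP/mapP=> -[i iW ->]; exists i => //;
  by move: iW; rewrite mem_enum.
Qed.

Lemma prec_restr (chi : 'I_n -> side) i j :
  prec (restr chi V) i j = prec chi (e i) (e j).
Proof. by rewrite /prec /restr -/e !enum_val_mono. Qed.

Lemma cross_imset chi (B D : {set 'I_#|V|}) :
  cross (prec chi) (e @: B) (e @: D) = cross (prec (restr chi V)) B D.
Proof.
apply/crossP/crossP.
  case=> x [y [z [t [[xB yD zB tD] [xy yz zt]]]]].
  move: xB yD zB tD xy yz zt => /imsetP[a aB ->] /imsetP[b bD ->].
  move=> /imsetP[c cB ->] /imsetP[d dD ->].
  by exists a, b, c, d; rewrite !prec_restr.
case=> [a [b [c [d [[aB bD cB dD] [ab bc cd]]]]]].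
by exists (e a), (e b), (e c), (e d); rewrite -!prec_restr !imset_f.
Qed.

(** [enum_val] carries the order of [restr chi V] to that of [chi] on [V], hence preserves
    crossings. *)
Lemma sum_BNC_restr (C : comNzRingType) chi (F : {set 'I_n} -> C) :
  \sum_(pi in BNC (restr chi V)) \prod_(B in pi) F (e @: B) =
  NCsum (prec chi) F V.
Proof.
rewrite sum_BNC -[V in RHS]imset_enum_val /NCsum.
rewrite (sum_partitions_imset _ _ _ enum_val_inj).
apply: eq_bigl => pi; congr (_ && _).
apply/noncrossingP/noncrossingP=> nc.
  move=> _ _ /imsetP[B piB ->] /imsetP[D piD ->] neq; rewrite cross_imset.
  by apply: nc => //; apply: contraNneq neq => ->.
move=> B D piB piD neq; rewrite -cross_imset; apply: nc; rewrite ?imset_f //.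
by rewrite (inj_eq (imset_inj enum_val_inj)).
Qed.

Lemma sum_BI_restr (C : comNzRingType) chi (F : {set 'I_n} -> C) :
  \sum_(pi in BI (restr chi V)) \prod_(B in pi) F (e @: B) =
  INTsum (prec chi) F V.
Proof.
rewrite sum_BI -[V in RHS]imset_enum_val /INTsum.
rewrite (sum_partitions_imset _ _ _ enum_val_inj).
apply: eq_bigl => pi; congr (_ && _).
have intE (B : {set 'I_#|V|}) :
    interval_in (prec chi) (e @: setT) (e @: B) =
    interval_in (prec (restr chi V)) setT B.
  apply/forall_inP/forall_inP=> h.
    move=> a aB; apply/forall_inP=> c cB; apply/forall_inP=> b bT.
    rewrite !prec_restr -(mem_imset B b enum_val_inj).
    have /forall_inP/(_ _ (imset_f e cB))/forall_inP/(_ (e b)) := h _ (imset_f e aB).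
    by apply; rewrite imset_f.
  move=> _ /imsetP[a aB ->]; apply/forall_inP=> _ /imsetP[c cB ->].
  apply/forall_inP=> _ /imsetP[b bT ->].
  rewrite -!prec_restr (mem_imset B b enum_val_inj).
  by have /forall_inP/(_ c cB)/forall_inP/(_ b bT) := h a aB.
apply/forall_inP/forall_inP=> h.
  by move=> _ /imsetP[B piB ->]; rewrite intE h.
by move=> B piB; rewrite -intE h ?imset_f.
Qed.

End EnumVal.

(** * The formulas for coefficients of series *)

Section Coefficients.

Variables (R : realType) (I J : choiceType).
Local Notation K := (I + J)%type.

Lemma Cf_restr n (alpha : 'I_n -> K) (V : {set 'I_n}) (f : series0 R I J) :
  Cf (restr alpha V) f = f (map alpha (enum V)).
Proof.
rewrite /Cf; congr (coef f _).
rewrite -[in RHS](imset_enum_val V) enum_imset -map_comp.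
by rewrite enum_setT -enumT.
Qed.

Lemma Cf_restr_restr n (alpha : 'I_n -> K) (V : {set 'I_n}) (W : {set 'I_#|V|})
    (f : series0 R I J) :
  Cf (restr (restr alpha V) W) f =
  Cf (restr alpha [set (enum_val i : 'I_n) | i in W]) f.
Proof. by rewrite !Cf_restr enum_imset -map_comp. Qed.

Lemma Cf_restrT n (alpha : 'I_n -> K) (f : series0 R I J) :
  Cf (restr alpha setT) f = Cf alpha f.
Proof. by rewrite Cf_restr enum_setT -enumT. Qed.

Lemma bReta_formulas (f g : series0 R I J) :
    (forall n (alpha : 'I_n -> K), (0 < n)%N ->
      \sum_(pi in BNC (chi_of alpha)) Cf_part alpha pi f =
      \sum_(pi in BI (chi_of alpha)) Cf_part alpha pi g) ->
  forall n (alpha : 'I_n -> K), (0 < n)%N ->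
    Cf alpha g =
      \sum_(pi in BNC (chi_of alpha) | ll (chi_of alpha) pi one_part)
        Cf_part alpha pi f /\
    Cf alpha f =
      \sum_(pi in BNC (chi_of alpha) | ll (chi_of alpha) pi one_part)
        (-1) ^+ (#|pi| - 1) * Cf_part alpha pi g.
Proof.
move=> fg n alpha n0; set chi := chi_of alpha.
pose F V := Cf (restr alpha V) f; pose G V := Cf (restr alpha V) g.
have so := prec_strict_order chi.
have T0 : [set: 'I_n] != set0 by apply/set0Pn; exists (Ordinal n0).
(* The hypothesis on the shorter word [restr alpha V] gives the equality on each subset [V]. *)
have FG V : NCsum (prec chi) F V = INTsum (prec chi) G V.
  case: (eqVneq V set0) => [->|V0]; first by rewrite NCsum0 ?INTsum0.
  rewrite -sum_BNC_restr -sum_BI_restr.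
  have := fg _ (restr alpha V); rewrite card_gt0 => /(_ V0).
  rewrite /Cf_part; under eq_bigr do under eq_bigr do rewrite Cf_restr_restr.
  by under [in RHS]eq_bigr do under eq_bigr do rewrite Cf_restr_restr.
have GF := INT_of_NC so FG.
split.
  by rewrite -Cf_restrT -/(G setT) GF // -sum_ll.
rewrite -Cf_restrT -/(F setT) [LHS](NCirr_involutive so _ T0) -sum_ll -sumrN.
apply: eq_bigr => pi /andP[]; rewrite inE => /andP[part _] _.
(* As [n > 0], [pi] has a block, so [#|pi| - 1] is not truncated. *)
have pi0 : (0 < #|pi|)%N.
  rewrite card_gt0; apply: contraNneq T0 => pi0.
  by rewrite -(cover_partition part) pi0 /cover big_set0.
(* Each block contributes a sign, and the outer minus brings the exponent from [#|pi|] to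
   [#|pi| - 1]. *)
rewrite (eq_bigr (fun V => (-1) * G V)) => [|V piV]; last first.
  by rewrite mulN1r GF // (partition_neq0 part).
rewrite big_split /= prodr_const -mulNr; congr (_ * _).
by rewrite -(prednK pi0) exprS mulN1r opprK subn1.
Qed.

End Coefficients.

(** * Cumulants and the transforms *)

(** Stands in for a cast along [m = n]: [h] keeps the values of the indices. *)
Lemma ord_reindex (T : Type) (X : Type) (c : forall n, ('I_n -> X) -> T) m n
    (h : 'I_m -> 'I_n) (x : 'I_n -> X) (y : 'I_m -> X) :
  m = n -> (forall i, h i = i :> nat) -> (forall i, y i = x (h i)) ->
  c m y = c n x.
Proof.
move=> mn hE yE; case: n / mn h x hE yE => h x hE yE; congr (c m _).
by apply: functional_extensionality => i; rewrite yE; congr x; apply: val_inj; apply: hE.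
Qed.

(* [#|[set: 'I_n]|] is only propositionally equal to [n]. *)
Lemma restr_setT (T X : Type) (c : forall n, ('I_n -> X) -> T) n (x : 'I_n -> X) :
  c #|[set: 'I_n]| (restr x setT) = c n x.
Proof.
apply: (@ord_reindex _ _ c _ _ enum_val) => //; first by rewrite cardsT card_ord.
move=> i; rewrite (enum_val_nth (enum_val i)) enum_setT -enumT.
by rewrite nth_enum_ord // -[X in (_ < X)%N](card_ord n) -cardsT.
Qed.

(** A full block would leave room for no other. The strict bound drives the recursions on [n]. *)
Lemma card_block n (pi : {set {set 'I_n}}) V : partition pi [set: 'I_n] ->
  pi != one_part -> V \in pi -> (0 < #|V| < n)%N.
Proof.
move=> part neq piV; rewrite card_gt0 (partition_neq0 part piV) /=.
rewrite -[X in (_ < X)%N](card_ord n) -cardsT proper_card // properT.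
apply: contraNneq neq => VT; rewrite VT in piV.
apply/eqP/setP=> W; rewrite inE; apply/idP/eqP => [piW|-> //].
case/set0Pn: (partition_neq0 part piW) => x xW.
by apply: (partition_block_eq part piW piV xW); rewrite inE.
Qed.

Lemma one_part_partition n : (0 < n)%N -> partition one_part [set: 'I_n].
Proof.
move=> n0; rewrite /partition /cover big_set1 eqxx trivIset1 inE eq_sym.
by apply/set0Pn; exists (Ordinal n0).
Qed.

(** * Existence of cumulants, for both families of partitions *)

Section CumulantExistence.

Variables (C : comNzRingType) (A : algType C).
Variables (P : forall n, ('I_n -> side) -> {set {set {set 'I_n}}}).
Hypothesis P_partition : forall n (chi : 'I_n -> side) pi,
  pi \in P chi -> partition pi [set: 'I_n].
Hypothesis P_one : forall n (chi : 'I_n -> side), (0 < n)%N -> one_part \in P chi.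
Variable phi : unital_functional A.

Lemma prod_one_part (c : functionals A) n (chi : 'I_n -> side) (x : 'I_n -> A) :
  \prod_(V in one_part) c #|V| (restr chi V) (restr x V) = c n chi x.
Proof.
rewrite big_set1.
(* Pairing [chi] with [x] lets one reindexing transport both. *)
exact: (@restr_setT _ _ (fun n z => c n (fun i => (z i).1) (fun i => (z i).2)) n
          (fun i => (chi i, x i))).
Qed.

(* The moment-cumulant formula, solved for the term of the one-block partition;
   [k] bounds the depth of the recursion. *)
Fixpoint cumulant_rec (k n : nat) (chi : 'I_n -> side) (x : 'I_n -> A) : C :=
  if k is k'.+1 then
    phi (\prod_(i < n) x i) -
    \sum_(pi in P chi | pi != one_part)
      \prod_(V in pi) cumulant_rec k' (restr chi V) (restr x V)
  else 0.

(** The recursion descends to strictly smaller blocks, so any bound of at least [n] is deep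
    enough. *)
Lemma cumulant_rec_stable k l n (chi : 'I_n -> side) (x : 'I_n -> A) :
  (0 < n)%N -> (n <= k)%N -> (n <= l)%N -> cumulant_rec k chi x = cumulant_rec l chi x.
Proof.
elim: k l n chi x => [|k IH] [|l] n chi x; try by case: n chi x.
move=> n0 nk nl /=; congr (_ - _); apply: eq_bigr => pi /andP[piP neq].
apply: eq_bigr => V piV.
have /andP[V0 Vn] := card_block (P_partition piP) neq piV.
by apply: IH; rewrite // -ltnS (leq_trans Vn).
Qed.

Lemma prod_dfwith_scalar n (x : 'I_n -> A) i :
  scalar (fun u : A => phi (\prod_(j < n) dfwith x (i := i) u j)).
Proof.
(* Splitting the index list at [i] leaves fixed products on both sides of [u]. *)
have [a [b ab]] : exists a b, forall u,
    \prod_(j < n) dfwith x (i := i) u j = a * (u * b).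
  have := index_enum_uniq 'I_n; have := mem_index_enum i.
  move: (index_enum _) => s /path.splitPr[s1 s2].
  rewrite cat_uniq => /and3P[_ /norP[i1 _] /andP[i2 _]].
  exists (\prod_(j <- s1) x j), (\prod_(j <- s2) x j) => u.
  rewrite big_cat big_cons dfwith_in /=; congr (_ * (_ * _)); apply: eq_big_seq => j js.
    by rewrite dfwith_out //; apply: contraNneq i1 => ->.
  by rewrite dfwith_out //; apply: contraNneq i2 => ->.
by move=> c u v; rewrite !ab mulrDl mulrDr -scalerAl -scalerAr linearP.
Qed.

(** In each partition only the factor of the block containing [i] depends on the varied argument. *)
Lemma cumulant_rec_multilinear k n (chi : 'I_n -> side) :
  multilinear (cumulant_rec k chi).
Proof.
elim: k n chi => [|k IH] n chi x i c u v /=; first by rewrite mulr0 addr0.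
rewrite prod_dfwith_scalar mulrBr addrACA -opprD mulr_sumr -big_split /=.
congr (_ - _); apply: eq_bigr => pi /andP[piP _]; have part := P_partition piP.
have piV : pblock pi i \in pi by rewrite pblock_mem ?(cover_partition part).
have iV : i \in pblock pi i by rewrite mem_pblock (cover_partition part).
rewrite !(bigD1 (pblock pi i) piV) /=.
have out u' : \prod_(V in pi | V != pblock pi i)
      cumulant_rec k (restr chi V) (restr (dfwith x (i := i) u') V) =
    \prod_(V in pi | V != pblock pi i)
      cumulant_rec k (restr chi V) (restr x V).
  apply: eq_bigr => V /andP[pV neq]; congr cumulant_rec.
  apply: functional_extensionality => j; rewrite /restr dfwith_out //.
  apply: contraNneq neq => ij; apply/eqP.
  by apply: (partition_block_eq part pV piV _ iV); rewrite ij enum_valP.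
have inn u' : restr (dfwith x (i := i) u') (pblock pi i) =
    dfwith (restr x (pblock pi i)) (i := enum_rank_in iV i) u'.
  have := enum_rankK_in iV iV; move: (enum_rank_in iV i) => j0 j0i.
  apply: functional_extensionality => j; rewrite /restr.
  case: (eqVneq j0 j) => [<-|neq]; first by rewrite dfwith_in j0i dfwith_in.
  rewrite !dfwith_out //; apply: contraNneq neq => ij.
  by apply/eqP/enum_val_inj; rewrite j0i.
by rewrite !out !inn IH mulrDl mulrA.
Qed.

Lemma cumulants_exist : exists kappa, cumulants_over P phi kappa.
Proof.
exists (fun n chi x => cumulant_rec n chi x); split.
  by move=> n chi _; apply: cumulant_rec_multilinear.
move=> n chi x n0; rewrite (bigD1 one_part) ?P_one //=.
rewrite (prod_one_part (fun n chi x => cumulant_rec n chi x)).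
case: n chi x n0 => // n chi x _; rewrite {1}/cumulant_rec -/cumulant_rec.
rewrite -[LHS](subrK (\sum_(pi in P chi | pi != one_part)
  \prod_(V in pi) cumulant_rec n (restr chi V) (restr x V))); congr (_ + _).
(* The unfolded recursion evaluates [V] with bound [n], the family with bound [#|V|]; both
   suffice. *)
apply: eq_bigr => pi /andP[piP neq]; apply: eq_bigr => V piV.
have /andP[V0 Vn] := card_block (P_partition piP) neq piV.
exact: cumulant_rec_stable.
Qed.

Lemma the_functionalsP :
  cumulants_over P phi (the_functionals (cumulants_over P phi)).
Proof. exact: epsilon_spec cumulants_exist. Qed.

End CumulantExistence.

Lemma BNC_partition n (chi : 'I_n -> side) pi :
  pi \in BNC chi -> partition pi [set: 'I_n].
Proof. by rewrite inE => /andP[]. Qed.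

Lemma BI_partition n (chi : 'I_n -> side) pi :
  pi \in BI chi -> partition pi [set: 'I_n].
Proof. by rewrite inE => /andP[]. Qed.

Lemma BNC_one n (chi : 'I_n -> side) : (0 < n)%N -> one_part \in BNC chi.
Proof.
move=> n0; rewrite inE one_part_partition //=.
apply/forall_inP=> V; rewrite inE => /eqP->; apply/forall_inP=> W.
by rewrite inE => /eqP->; rewrite eqxx.
Qed.

Lemma BI_one n (chi : 'I_n -> side) : (0 < n)%N -> one_part \in BI chi.
Proof.
move=> n0; rewrite inE one_part_partition //=.
apply/forall_inP=> V; rewrite inE => /eqP->.
apply/forall_inP=> a _; apply/forall_inP=> c _; apply/forallP=> b.
by rewrite inE implybT.
Qed.

(** * Moments in terms of the transforms; surjectivity of [Rtransform] *)

Section Transforms.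

Variables (R : realType) (I J : choiceType).
Local Notation C := R[i].
Local Notation K := (I + J)%type.
Implicit Types (f g : series0 R I J) (mu : Dalg R I J).

Lemma series0_eq f g : (forall w, f w = g w) -> f = g.
Proof.
case: f g => [f f0] [g g0] /= fg.
have {}fg : f = g by apply: functional_extensionality.
by case: g / fg g0 => g0; congr Series0; apply: eq_irrelevance.
Qed.

Lemma word_fun (T : Type) (c : forall n, ('I_n -> K) -> T) n (alpha : 'I_n -> K)
    (w : seq K) : w = [seq alpha k | k <- enum 'I_n] ->
  c (size w) (tnth (in_tuple w)) = c n alpha.
Proof.
move=> ->; set w' := map _ _.
have sw : size w' = n by rewrite size_map size_enum_ord.
apply: (@ord_reindex _ _ c _ _ (cast_ord sw)) => // i.
have i' : (i < n)%N by rewrite -[X in (_ < X)%N]sw.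
rewrite (tnth_nth (alpha (Ordinal i'))) /= (nth_map (Ordinal i')) ?size_enum_ord //.
by congr alpha; apply: val_inj; rewrite /= nth_enum_ord //.
Qed.

Lemma Cf_series_of (c : forall n, ('I_n -> K) -> C) n (alpha : 'I_n -> K) :
  (0 < n)%N -> Cf alpha (series_of c) = c n alpha.
Proof.
move=> n0; rewrite /Cf /=; set w := map _ _.
rewrite -(@word_fun _ c n alpha w) //.
have : size w != 0%N by rewrite size_map size_enum_ord -lt0n.
by clearbody w; case: w.
Qed.

Lemma series0_eq_Cf f g :
  (forall n (alpha : 'I_n -> K), (0 < n)%N -> Cf alpha f = Cf alpha g) -> f = g.
Proof.
move=> fg; apply: series0_eq => -[|a w]; first by rewrite !coef_nil.
have := fg _ (tnth (in_tuple (a :: w))) isT.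
by rewrite /Cf map_tnth_enum.
Qed.

Lemma prod_ncvar n (alpha : 'I_n -> K) :
  \prod_(i < n) ncvar C (alpha i) =
  << FMonom [seq alpha k | k <- enum 'I_n] >> :> ncpoly C K.
Proof.
rewrite -[index_enum _]enumT; elim: (enum _) => [|i s IH].
  by rewrite big_nil -[LHS]/(<< fmone K >>) fmoneE.
rewrite big_cons IH /ncvar fmuE.
transitivity (<< fmmul (FMonom [:: alpha i]) (FMonom [seq alpha k | k <- s]) >>
  : ncpoly C K); last by rewrite fmmulE.
by rewrite -[LHS]/(_ * _ : {malg C[{fmonom K}]}) malgM_def fgmulUU mulr1.
Qed.

(** * The functional with prescribed moments *)

Section MomentFunctional.

Variable mom : seq K -> C.
Hypothesis mom_nil : mom [::] = 1.

Definition functional_of (p : ncpoly C K) : C :=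
  mmap idfun (fun k : {fmonom K} => mom k) p.

Fact functional_of_is_scalar : scalar functional_of.
Proof.
move=> c p q; rewrite /functional_of mmapD; congr (_ + _).
rewrite (mmapEw (msuppZ_le _ _)) mmapE mulr_sumr.
by apply: eq_bigr => k _; rewrite /= mcoeffZ mulrA.
Qed.

HB.instance Definition _ :=
  GRing.isLinear.Build C (ncpoly C K) C _ functional_of functional_of_is_scalar.

Lemma functional_ofU (w : seq K) : functional_of << FMonom w >> = mom w.
Proof. by rewrite /functional_of mmapU mul1r. Qed.

Lemma functional_of1 : functional_of 1 = 1.
Proof. by rewrite -[X in functional_of X]/(<< fmone K >>) fmoneE functional_ofU. Qed.

Definition Dalg_of : Dalg R I J := UnitalFunctional functional_of1.

End MomentFunctional.

(** The moment-cumulant formula on variables. Blocks are nonempty, so the value [0] on the empty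
    word never enters, and [chi_of (restr alpha V)] is convertible to [restr (chi_of alpha) V]. *)
Lemma restr_moments (c : forall n, ('I_n -> side) -> ('I_n -> ncpoly C K) -> C)
    mu (P : forall n, ('I_n -> side) -> {set {set {set 'I_n}}})
    n (alpha : 'I_n -> K) :
  (forall m (chi : 'I_m -> side) pi, pi \in P m chi -> partition pi [set: 'I_m]) ->
  cumulants_over P mu c -> (0 < n)%N ->
  mu << FMonom [seq alpha k | k <- enum 'I_n] >> =
  \sum_(pi in P n (chi_of alpha)) Cf_part alpha pi
    (series_of (fun m beta => c m (chi_of beta) (fun k => ncvar C (beta k)))).
Proof.
move=> P_partition [_ cP] n0; rewrite -prod_ncvar (cP _ (chi_of alpha)) //.
apply: eq_bigr => pi /P_partition part; apply: eq_bigr => V piV.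
by rewrite Cf_series_of // card_gt0 (partition_neq0 part).
Qed.

Lemma Rtransform_moments mu n (alpha : 'I_n -> K) : (0 < n)%N ->
  mu << FMonom [seq alpha k | k <- enum 'I_n] >> =
  \sum_(pi in BNC (chi_of alpha)) Cf_part alpha pi (Rtransform mu).
Proof.
apply: restr_moments; first exact: BNC_partition.
exact: the_functionalsP BNC_partition BNC_one _.
Qed.

Lemma eta_transform_moments mu n (alpha : 'I_n -> K) : (0 < n)%N ->
  mu << FMonom [seq alpha k | k <- enum 'I_n] >> =
  \sum_(pi in BI (chi_of alpha)) Cf_part alpha pi (eta_transform mu).
Proof.
apply: restr_moments; first exact: BI_partition.
exact: the_functionalsP BI_partition BI_one _.
Qed.

(** By induction on the length of the word: every partition but [one_part] involves shorter words
    only, so the one-block coefficients agree. *)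
Lemma BNC_sum_inj f g :
    (forall n (alpha : 'I_n -> K), (0 < n)%N ->
      \sum_(pi in BNC (chi_of alpha)) Cf_part alpha pi f =
      \sum_(pi in BNC (chi_of alpha)) Cf_part alpha pi g) ->
  f = g.
Proof.
move=> fg; apply: series0_eq_Cf; elim/ltn_ind=> n IH alpha n0.
have := fg n alpha n0; rewrite !(bigD1 one_part (BNC_one _ n0)) /=.
rewrite [X in _ + X = _ -> _](eq_bigr (fun pi => Cf_part alpha pi g)); last first.
  move=> pi /andP[/BNC_partition part neq]; apply: eq_bigr => V piV.
  by have /andP[V0 Vn] := card_block part neq piV; apply: IH.
by move/addIr; rewrite /Cf_part !big_set1 !Cf_restrT.
Qed.

Lemma Rtransform_surj f : exists mu, Rtransform mu = f.
Proof.
(* The moments that [f] prescribes; the value [1] on the empty word makes the functional unital. *)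
pose mom (w : seq K) : C := if w is [::] then 1 else
  \sum_(pi in BNC (chi_of (tnth (in_tuple w)))) Cf_part (tnth (in_tuple w)) pi f.
exists (@Dalg_of mom erefl); apply: BNC_sum_inj => n alpha n0.
rewrite -Rtransform_moments //= functional_ofU.
transitivity (Cf alpha (series_of (fun n (beta : 'I_n -> K) =>
  \sum_(pi in BNC (chi_of beta)) Cf_part beta pi f))); last exact: Cf_series_of.
rewrite /Cf /=; set w := map _ _.
have : size w != 0%N by rewrite size_map size_enum_ord -lt0n.
by clearbody w; case: w.
Qed.

Lemma Rtransform_invK f : Rtransform (Rtransform_inv f) = f.
Proof. exact: epsilon_spec (Rtransform_surj f). Qed.

End Transforms.

Theorem proposition7p4 (R : realType) (I J : choiceType) (f g : series0 R I J)
    (hfg : bReta f = g) :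
  (forall (n : nat) (alpha : 'I_n -> (I + J)%type), (0 < n)%N ->
     Cf alpha g =
     \sum_(pi in BNC (chi_of alpha) | ll (chi_of alpha) pi one_part)
        Cf_part alpha pi f) /\
  (forall (n : nat) (alpha : 'I_n -> (I + J)%type), (0 < n)%N ->
     Cf alpha f =
     \sum_(pi in BNC (chi_of alpha) | ll (chi_of alpha) pi one_part)
        (-1) ^+ (#|pi| - 1) * Cf_part alpha pi g).
Proof.
have fg n (alpha : 'I_n -> (I + J)%type) : (0 < n)%N ->
    \sum_(pi in BNC (chi_of alpha)) Cf_part alpha pi f =
    \sum_(pi in BI (chi_of alpha)) Cf_part alpha pi g.
  (* Both sums equal the moment of the word under [Rtransform_inv f]. *)
  move=> n0; rewrite -{1}(Rtransform_invK f) -hfg.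
  by rewrite -Rtransform_moments // -eta_transform_moments.
by split=> n alpha n0; case: (bReta_formulas fg alpha n0).
Qed.
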